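(* Let $\gamma_1,\gamma_2>0$ and $t\in[0,1)$. For any $K\ge 1$, $$\mathbb{E}\big\langle (Q_{1,1}-\langle Q_{1,1}\rangle_y)^2\big\rangle_y\le I(K)+\frac{4(\gamma_1+\gamma_2)}{\gamma_1\gamma_2\sqrt{|E|(1-t)}},$$ where $$I(K):=\frac{16}{|E|}\sum_{e\in E}\Big(\mathbb{E}\big[|y_{1,e}|^2;|y_{1,e}|\ge K\big]+\mathbb{E}\big[|y_{2,e}|^2;|y_{2,e}|\ge K\big]\Big)+36K(\gamma_1+\gamma_2)\sqrt{1-t}.$$ If $B_{1,3}:=\max_{e\in E}\mathbb{E}|y_{1,e}|^3$ and $B_{2,3}:=\max_{e\in E}\mathbb{E}|y_{2,e}|^3$ are finite, then $$\mathbb{E}\big\langle (Q_{1,1}-\langle Q_{1,1}\rangle_y)^2\big\rangle_y\le 36(B_{1,3}\gamma_1+B_{2,3}\gamma_2)\sqrt{1-t}+\frac{4(\gamma_1+\gamma_2)}{\gamma_1\gamma_2\sqrt{|E|(1-t)}}.$$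
   Context: $\Sigma$ is a finite set, $E$ is a finite index set, and $(f_e)_{e\in E}$ is a family of measurable functions on $\Sigma$ with $|f_e|\le 1$. The random variables $(y_e)_{e\in E}$, $(y_{1,e})_{e\in E}$, $(y_{2,e})_{e\in E}$ are all independent of each other, each with mean zero and variance one. $\mu_1,\mu_2$ are two random (nonzero, finite) measures on $\Sigma$, the pair $(\mu_1,\mu_2)$ being independent of all these random variables. The Hamiltonians on $\Sigma$ are $$H_{1,y}(\rho)=\gamma_1\sum_{e\in E}f_e(\rho)(\sqrt{t}\,y_e+\sqrt{1-t}\,y_{1,e}),\qquad H_{2,y}(\tau)=\gamma_2\sum_{e\in E}f_e(\tau)(\sqrt{t}\,y_e+\sqrt{1-t}\,y_{2,e}),$$ and the Gibbs measures are $dG_{1,y}(\rho)=\exp(H_{1,y}(\rho))\,d\mu_1(\rho)/Z_{1,y}$ and $dG_{2,y}(\tau)=\exp(H_{2,y}(\tau))\,d\mu_2(\tau)/Z_{2,y}$, with $Z_{1,y},Z_{2,y}$ the normalizing factors. $(\rho^\ell,\tau^\ell)_{\ell\ge1}$ is an i.i.d. sequence sampled from the product measure $G_{1,y}\times G_{2,y}$, $\langle\cdot\rangle_y$ is the expectation with respect to $\prod_{\ell\ge 1}(G_{1,y}\times G_{2,y})$, and $\mathbb{E}$ is the expectation with respect to all remaining randomness. The cross overlap is $Q_{\ell,\ell'}=\frac{1}{|E|}\sum_{e\in E}f_e(\rho^\ell)f_e(\tau^{\ell'})$. For a random variable $X$ and event $A$, $\mathbb{E}[X;A]=\mathbb{E}[X\mathbf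 1_A]$. *)

(* Defs.v *)
From HB Require Import structures.
From mathcomp Require Import all_boot all_order all_algebra.
From mathcomp Require Import all_classical all_reals all_analysis.
From mathcomp Require Import measurable_realfun.

Set Implicit Arguments.
Unset Strict Implicit.
Unset Printing Implicit Defensive.

Import Order.TTheory GRing.Theory Num.Theory.
Import numFieldNormedType.Exports.

Local Open Scope classical_set_scope.
Local Open Scope ring_scope.

Section independence.
Context d (T : measurableType d) (R : realType) (P : probability T R).
Local Open Scope ereal_scope.

Definition mutually_independent (I : finType) (X : I -> T -> R) : Prop :=
  forall (J : {set I}) (A : I -> set T),
    (forall i, i \in J -> g_sigma_algebra_preimage (X i) (A i)) ->
    P (\bigcap_(i in [set` J]) A i) = \prod_(i in J) P (A i).

Definition sigma_independent (F G : set (set T)) : Prop :=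
  forall A B, F A -> G B -> P (A `&` B) = P A * P B.

Definition sigma_family (I : finType) (X : I -> T -> R) : set (set T) :=
  <<s \bigcup_i g_sigma_algebra_preimage (X i) >>.

(* A random measure is a transition kernel k, and the sigma-algebra it
   generates is that of the evaluations w |-> k w A with A measurable. *)
Definition sigma_random_measures d' (S : measurableType d')
    (k1 k2 : T -> {measure set S -> \bar R}) : set (set T) :=
  <<s \bigcup_(A in @measurable _ S)
        (g_sigma_algebra_preimage (k1 ^~ A) `|`
         g_sigma_algebra_preimage (k2 ^~ A)) >>.

Definition expectation_on (X : T -> R) (A : set T) : \bar R :=
  'E_P[(X \* \1_A)%R].

End independence.

Definition disorder (E T R : Type) (y y1 y2 : E -> T -> R)
    (i : (E + E + E)%type) : T -> R :=
  match i with
  | inl (inl e) => y e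
  | inl (inr e) => y1 e
  | inr e => y2 e
  end.

Section gibbs.
Context d (S : measurableType d) (R : realType) (E : finType).

Definition hamiltonian (f : E -> S -> R) (gamma t : R) (u v : E -> R) (x : S)
    : R :=
  gamma * \sum_(e : E) f e x * (Num.sqrt t * u e + Num.sqrt (1 - t) * v e).

Definition gibbs (mu : {measure set S -> \bar R}) (H : S -> R) (A : set S)
    : \bar R :=
  ((\int[mu]_x expR (H x))%R^-1)%:E * \int[mu]_(x in A) (expR (H x))%:E.

(* Expectation of a function of one pair (rho, tau): the image of the product
   over all replica pairs of G1 x G2 under a single coordinate is G1 x G2. *)
Definition replica_expectation (G1 G2 : set S -> \bar R) (h : S * S -> R) : R :=
  fine (\int[G1 \x G2]_x (h x)%:E).

(* For empty E this is 0, by the convention 0^-1 = 0. *)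
Definition cross_overlap (f : E -> S -> R) (x : S * S) : R :=
  #|E|%:R^-1 * \sum_(e : E) f e x.1 * f e x.2.

Definition overlap_variance (f : E -> S -> R) (G1 G2 : set S -> \bar R) : R :=
  let Q := cross_overlap f in
  replica_expectation G1 G2
    (fun x => (Q x - replica_expectation G1 G2 Q) ^+ 2).

End gibbs.

Section bounds.
Context d (T : measurableType d) (R : realType) (P : probability T R).
Context (E : finType).
Local Open Scope ereal_scope.

Definition truncation_bound (y1 y2 : E -> T -> R) (gamma1 gamma2 t K : R)
    : \bar R :=
  let tail (X : T -> R) :=
    expectation_on P (fun w => `|X w| ^+ 2)%R [set w | (K <= `|X w|)%R] in
  (16 / #|E|%:R)%:E * \sum_(e : E) (tail (y1 e) + tail (y2 e))
  + (36 * K * (gamma1 + gamma2) * Num.sqrt (1 - t))%:E.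

(* The moments are nonnegative, so starting at 0 yields their maximum. *)
Definition max_third_moment (X : E -> T -> R) : \bar R :=
  \big[maxe/0]_(e : E) 'E_P[(fun w => `|X e w| ^+ 3)%R].

End bounds.

(* Main.v *)
Require Import Defs.
From HB Require Import structures.
From mathcomp Require Import all_boot all_order all_algebra.
From mathcomp Require Import all_classical all_reals all_analysis.
From mathcomp Require Import measurable_realfun.
From mathcomp Require Import ring lra.

Set Implicit Arguments.
Unset Strict Implicit.
Unset Printing Implicit Defensive.

Import Order.TTheory GRing.Theory Num.Theory.
Import numFieldNormedType.Exports.

Local Open Scope classical_set_scope.
Local Open Scope ring_scope.

(** Write [rho] and [tau] for samples of the two Gibbs measures, [Q] for their
    overlap, [c1 = gamma1 * sqrt (1 - t)] and [c2 = gamma2 * sqrt (1 - t)].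

    The Efron-Stein inequality ([efron_stein]) bounds the variance of [Q] by the
    mean conditional variance of [Q] given [tau] plus the one given [rho]. The
    two terms are alike, so consider the first. Let [F_e(s)] be the Gibbs
    average of [f_e(tau) Q], seen as a function of the value [s] of the variable
    [y_{1,e}], which acts on [rho] only. Its derivative is [c1] times the
    covariance in [rho] of [f_e(tau) Q] and [f_e(rho)]. Averaged over [e], the
    product [f_e(rho) f_e(tau)] becomes an overlap, and these derivatives sum
    up to exactly [c1] times the conditional variance of [Q] given [tau].

    If [y_{1,e}] were Gaussian, integration by parts would give the mean of
    [F_e'(y_{1,e})] as the mean of [y_{1,e} F_e(y_{1,e})]. For other laws of
    mean zero and variance one this holds up to a Taylor error
    ([approximate_integration_by_parts]), because [F_e(0)] and [F_e'(0)] do not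
    depend on [y_{1,e}]; the error is of order [c1] times the second moment of
    [y_{1,e}] on the event [K <= `|y_{1,e}|] plus [c1 ^+ 2 * K], and also of
    order [c1 ^+ 2] times the third moment.

    It remains to bound the mean over [e] of [y_{1,e} F_e(y_{1,e})], which is
    the Gibbs average of [L(tau) Q] with [L(tau)] the mean over [e] of
    [y_{1,e} f_e(tau)]. The overlap is at most 1, and the law of [tau] is
    independent of the variables [y_{1,e}], which are uncorrelated; so [L(tau)]
    has second moment at most [#|E|^-1]. After division by [c1] this produces
    the term of order [(c1 * sqrt #|E|)^-1] ([mean_cond_var_le]).

    Two devices make this rigorous. The functions [f_e] have finitely many joint
    values, so that all Gibbs averages are finite sums over these levels
    ([finite_levels], [gibbs_levels]), with weights that are random variables.
    Independence of one disorder variable from all the remaining randomness is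
    stated through the sigma-algebra generated by the latter
    ([leave_one_out_indep]); functions measurable for it factor out of
    expectations ([observable_indep]). *)

(** * Exponentially tilted averages *)

Section weighted_average.
Context {R : realType} {I : finType}.
Implicit Types (w phi a : I -> R).

Definition avg w phi := (\sum_i w i * phi i) / \sum_i w i.

Lemma avg_norm_le w phi (C : R) : (forall i, 0 <= w i) -> 0 <= C ->
  (forall i, `|phi i| <= C) -> `|avg w phi| <= C.
Proof.
move=> w0 C0 phiC; rewrite /avg normrM normfV.
have W0 : 0 <= \sum_i w i by apply: sumr_ge0.
rewrite (ger0_norm W0).
have [->|Wn0] := eqVneq (\sum_i w i) 0; first by rewrite invr0 mulr0.
rewrite ler_pdivrMr ?lt_def ?Wn0// mulr_sumr.
apply: le_trans (ler_norm_sum _ _ _) _; apply: ler_sum => i _.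
by rewrite normrM (ger0_norm (w0 i)) mulrC ler_wpM2r.
Qed.

(** Gibbs weights as a function of the value [s] of a single disorder variable,
    all other variables being absorbed in [w]. *)
Definition tilt w a (c s : R) i := w i * expR (s * (c * a i)).

Lemma tilt_ge0 w a c s i : 0 <= w i -> 0 <= tilt w a c s i.
Proof. by move=> w0; rewrite mulr_ge0// expR_ge0. Qed.

Lemma tilt_sum_gt0 w a c s : (forall i, 0 <= w i) -> 0 < \sum_i w i ->
  0 < \sum_i tilt w a c s i.
Proof.
move=> w0 W0; rewrite lt_def sumr_ge0 ?andbT; last first.
  by move=> i _; exact: tilt_ge0.
rewrite psumr_neq0; last by move=> i _; exact: tilt_ge0.
move: (W0); rewrite lt_def psumr_neq0 => [|i _]; last exact: w0.
move=> /andP[/hasP[i iI wi] _]; apply/hasP; exists i => //=.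
by rewrite mulr_gt0// expR_gt0.
Qed.

Lemma is_derive_sum_tilt w a c phi (s : R) :
  is_derive s 1 (fun x : R => \sum_i tilt w a c x i * phi i)
    (c * \sum_i tilt w a c s i * (phi i * a i)).
Proof.
have h i : is_derive s 1 (fun x : R => tilt w a c x i * phi i)
    (c * (tilt w a c s i * (phi i * a i))).
  rewrite /tilt; apply: is_derive_eq; rewrite /GRing.scale/=; ring.
rewrite mulr_sumr.
have -> : (fun x : R => \sum_i tilt w a c x i * phi i) =
   \sum_(i <- index_enum I) (fun x : R => tilt w a c x i * phi i).
  by apply/funext => x; rewrite fct_sumE.
elim: (index_enum I) => [|i r IH]; first by rewrite !big_nil; exact: is_derive_cst.
rewrite !big_cons; exact: is_deriveD.
Qed.

Definition tilted_avg w a c phi (s : R) := avg (tilt w a c s) phi.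

(** The derivative of [tilted_avg] in [s], by [is_derive_tilted_avg]. *)
Definition tilted_cov w a c phi (s : R) := c *
  (tilted_avg w a c (fun i => phi i * a i) s -
   tilted_avg w a c phi s * tilted_avg w a c a s).

Lemma is_derive_tilted_avg w a c phi (s : R) :
  (forall i, 0 <= w i) -> 0 < \sum_i w i ->
  is_derive s 1 (tilted_avg w a c phi) (tilted_cov w a c phi s).
Proof.
move=> w0 W0.
have Z0 : \sum_i tilt w a c s i != 0 by rewrite gt_eqF// tilt_sum_gt0.
have dN := is_derive_sum_tilt w a c phi s.
have dZ : is_derive s 1 (fun x : R => \sum_i tilt w a c x i)
    (c * \sum_i tilt w a c s i * a i).
  have := is_derive_sum_tilt w a c (fun=> 1) s.
  by under eq_fun do under eq_bigr do rewrite mulr1;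
    under eq_bigr do rewrite mul1r.
have dV := is_deriveV Z0 dZ.
have -> : tilted_avg w a c phi = (fun x : R => \sum_i tilt w a c x i * phi i) *
   (fun x : R => (\sum_i tilt w a c x i)^-1) by [].
apply: is_derive_eq; rewrite /GRing.scale/= /tilted_cov /tilted_avg /avg/=.
by field.
Qed.

Section taylor.
Variables (w a phi : I -> R) (c : R).
Hypotheses (w0 : forall i, 0 <= w i) (W0 : 0 < \sum_i w i) (c0 : 0 <= c).
Hypotheses (a1 : forall i, `|a i| <= 1) (phi1 : forall i, `|phi i| <= 1).

Lemma tilted_avg_norm_le1 psi s : (forall i, `|psi i| <= 1) ->
  `|tilted_avg w a c psi s| <= 1.
Proof. by move=> psi1; apply: avg_norm_le => // i; exact: tilt_ge0. Qed.

Lemma norm_mul_le1 (x y : R) : `|x| <= 1 -> `|y| <= 1 -> `|x * y| <= 1.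
Proof. by move=> x1 y1; rewrite normrM mulr_ile1. Qed.

Lemma tilted_cov_norm_le psi s : (forall i, `|psi i| <= 1) ->
  `|tilted_cov w a c psi s| <= 2 * c.
Proof.
move=> psi1; rewrite /tilted_cov normrM (ger0_norm c0) mulrC ler_wpM2r//.
apply: le_trans (ler_normB _ _) _; rewrite (_ : 2 = 1 + 1)//; apply: lerD.
  by apply: tilted_avg_norm_le1 => i; exact: norm_mul_le1.
by apply: norm_mul_le1; exact: tilted_avg_norm_le1.
Qed.

Lemma tilted_avg_mvt psi s : (forall i, `|psi i| <= 1) ->
  exists2 x, `|x| <= `|s| &
    tilted_avg w a c psi s - tilted_avg w a c psi 0 = tilted_cov w a c psi x * s.
Proof.
move=> psi1.
have D (x : R) : is_derive x 1 (tilted_avg w a c psi) (tilted_cov w a c psi x).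
  exact: is_derive_tilted_avg.
have C (u v : R) : {within `[u, v], continuous (tilted_avg w a c psi)}.
  apply: derivable_within_continuous => x _; by have [] := D x.
have [s0|s0] := leP 0 s.
  have [x] := MVT_segment s0 (fun x _ => D x) (C _ _).
  rewrite in_itv/= => /andP[x0 xs] ->; exists x; last by rewrite subr0.
  by rewrite !ger0_norm.
have [x] := MVT_segment (ltW s0) (fun x _ => D x) (C _ _).
rewrite in_itv/= => /andP[xs x0] E; exists x.
  by rewrite !ler0_norm ?(ltW s0)// lerN2.
by rewrite -opprB E sub0r mulrN opprK.
Qed.

Lemma tilted_avg_lip psi s : (forall i, `|psi i| <= 1) ->
  `|tilted_avg w a c psi s - tilted_avg w a c psi 0| <= 2 * c * `|s|.
Proof.
move=> psi1; have [x _ ->] := tilted_avg_mvt s psi1.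
by rewrite normrM ler_wpM2r// tilted_cov_norm_le.
Qed.

(** A tilted covariance is a polynomial in tilted averages of functions bounded
    by 1, each of which is [2 * c]-Lipschitz; so no second derivative has to be
    computed. *)
Lemma tilted_cov_lip s :
  `|tilted_cov w a c phi s - tilted_cov w a c phi 0| <= 6 * c ^+ 2 * `|s|.
Proof.
rewrite /tilted_cov.
set A := tilted_avg _ _ _ (fun i => _).
set B := tilted_avg _ _ _ phi; set C := tilted_avg _ _ _ a.
have -> : c * (A s - B s * C s) - c * (A 0 - B 0 * C 0) =
  c * ((A s - A 0) - (B s - B 0) * C s - B 0 * (C s - C 0)) by ring.
rewrite normrM (ger0_norm c0).
have -> : 6 * c ^+ 2 * `|s| = c * (2 * c * `|s| + 2 * c * `|s| + 2 * c * `|s|).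
  by ring.
apply: ler_wpM2l => //.
have k0 : 0 <= 2 * c * `|s| by rewrite !mulr_ge0.
apply: le_trans (ler_normB _ _) _; apply: lerD.
  apply: le_trans (ler_normB _ _) _; apply: lerD.
    by apply: tilted_avg_lip => i; exact: norm_mul_le1.
  rewrite normrM -[leRHS]mulr1; apply: ler_pM => //; first exact: tilted_avg_lip.
  exact: tilted_avg_norm_le1.
rewrite normrM -[leRHS]mul1r; apply: ler_pM => //; last exact: tilted_avg_lip.
exact: tilted_avg_norm_le1.
Qed.

(** Two bounds compete: the first order terms are each at most [2 * c * `|s|],
    and the mean value theorem turns the remainder into the increment of
    [tilted_cov] over a distance at most [`|s|]. The first is better for large
    [s]. *)
Lemma tilted_avg_taylor s :
  `|tilted_avg w a c phi s - tilted_avg w a c phi 0 - tilted_cov w a c phi 0 * s| <=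
  c * Num.min (4 * `|s|) (6 * c * `|s| ^+ 2).
Proof.
have [x xs E] := tilted_avg_mvt s phi1.
rewrite minr_pMr// le_min; apply/andP; split.
  rewrite E -mulrBl normrM mulrA ler_wpM2r//.
  apply: le_trans (ler_normB _ _) _.
  rewrite (_ : c * 4 = 2 * c + 2 * c); last by ring.
  by apply: lerD; exact: tilted_cov_norm_le.
rewrite E -mulrBl normrM.
have -> : c * (6 * c * `|s| ^+ 2) = (6 * c ^+ 2 * `|s|) * `|s| by ring.
apply: ler_wpM2r => //; apply: le_trans (tilted_cov_lip x) _.
by rewrite ler_wpM2l// mulr_ge0 ?sqr_ge0.
Qed.

End taylor.

End weighted_average.

Lemma sum_exp_gt0 (R : realType) (I : finType) (m h : I -> R) :
  (forall i, 0 <= m i) -> 0 < \sum_i m i -> 0 < \sum_i m i * expR (h i).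
Proof.
move=> m0 M0; have := @tilt_sum_gt0 _ _ m h 1 1 m0 M0.
by rewrite /tilt; under eq_bigr do rewrite !mul1r.
Qed.

(** * The Efron-Stein inequality for two finite laws *)

Definition mean_cond_var (R : realFieldType) (I K : finType)
    (p : I -> R) (q : K -> R) (h : I -> K -> R) : R :=
  \sum_k q k * (\sum_j p j * h j k ^+ 2 - (\sum_j p j * h j k) ^+ 2).

(** With [A] and [B] the two conditional means of [h] and [M] its mean, the
    gap between the two sides is the mean of the square
    [(h j k - A j - B k + M) ^+ 2]. *)
Lemma efron_stein {R : realFieldType} {I K : finType}
    (p : I -> R) (q : K -> R) (h : I -> K -> R) :
  (forall j, 0 <= p j) -> (forall k, 0 <= q k) ->
  \sum_j p j = 1 -> \sum_k q k = 1 ->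
  \sum_j \sum_k p j * q k * (h j k - \sum_j' \sum_k' p j' * q k' * h j' k') ^+ 2
  <= mean_cond_var p q h + mean_cond_var q p (fun k j => h j k).
Proof.
move=> p0 q0 p1 q1; rewrite /mean_cond_var.
pose M := \sum_j \sum_k p j * q k * h j k; rewrite -/M.
pose J (g : I -> K -> R) := \sum_j \sum_k p j * q k * g j k.
pose A j := \sum_k q k * h j k; pose B k := \sum_j p j * h j k.
have JD g g' : J (fun j k => g j k + g' j k) = J g + J g'.
  rewrite /J -big_split; apply: eq_bigr => j _ /=; rewrite -big_split.
  by apply: eq_bigr => k _ /=; rewrite mulrDr.
have JZ r g : J (fun j k => r * g j k) = r * J g.
  rewrite /J mulr_sumr; apply: eq_bigr => j _; rewrite mulr_sumr.
  by apply: eq_bigr => k _; rewrite mulrCA.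
have Jl u g : J (fun j k => u j * g j k) = \sum_j p j * (u j * \sum_k q k * g j k).
  rewrite /J; apply: eq_bigr => j _; rewrite !mulr_sumr.
  by apply: eq_bigr => k _; ring.
have Jr u g : J (fun j k => u k * g j k) = \sum_k q k * (u k * \sum_j p j * g j k).
  rewrite /J exchange_big; apply: eq_bigr => k _; rewrite !mulr_sumr.
  by apply: eq_bigr => j _; ring.
have ME : J h = M by [].
have J1 : J (fun _ _ => 1) = 1.
  rewrite /J -[RHS]p1; apply: eq_bigr => j _.
  by under eq_bigr do rewrite mulr1; rewrite -mulr_sumr q1 mulr1.
have JA : J (fun j _ => A j) = M.
  have := Jl A (fun _ _ => 1); rewrite -ME.
  under [X in J X = _]eq_fun do under eq_fun do rewrite mulr1.
  move=> ->; rewrite /J; apply: eq_bigr => j _.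
  under eq_bigr do rewrite mulr1; rewrite q1 mulr1 mulr_sumr.
  by apply: eq_bigr => k _; ring.
have JB : J (fun _ k => B k) = M.
  have := Jr B (fun _ _ => 1); rewrite -ME.
  under [X in J X = _]eq_fun do under eq_fun do rewrite mulr1.
  move=> ->; rewrite /J exchange_big; apply: eq_bigr => k _ /=.
  under eq_bigr do rewrite mulr1; rewrite p1 mulr1 mulr_sumr.
  by apply: eq_bigr => j _; ring.
pose a2 := \sum_j p j * A j ^+ 2; pose b2 := \sum_k q k * B k ^+ 2.
have JAh : J (fun j k => A j * h j k) = a2.
  by rewrite Jl; apply: eq_bigr => j _.
have JBh : J (fun j k => B k * h j k) = b2.
  by rewrite Jr; apply: eq_bigr => k _.
have JAA : J (fun j k => A j * A j) = a2.
  rewrite (Jl A (fun j _ => A j)); apply: eq_bigr => j _.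
  by rewrite -mulr_suml q1 mul1r.
have JBB : J (fun j k => B k * B k) = b2.
  rewrite (Jr B (fun _ k => B k)); apply: eq_bigr => k _.
  by rewrite -mulr_suml p1 mul1r.
have JAB : J (fun j k => A j * B k) = M ^+ 2.
  rewrite (Jl A (fun _ k => B k)) expr2 -{1}JA.
  have -> : \sum_k q k * B k = M.
    rewrite -ME /J exchange_big; apply: eq_bigr => k _ /=; rewrite mulr_sumr.
    by apply: eq_bigr => j _; ring.
  rewrite /J mulr_suml; apply: eq_bigr => j _ /=.
  by rewrite -mulr_suml -mulr_sumr q1 mulr1 mulrA.
pose S := J (fun j k => h j k ^+ 2).
have -> : \sum_j \sum_k p j * q k * (h j k - M) ^+ 2 = S - M ^+ 2.
  transitivity (J (fun j k => h j k ^+ 2 + ((- 2 * M) * h j k + M ^+ 2 * 1))).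
    by apply: eq_bigr => j _; apply: eq_bigr => k _; congr (_ * _); ring.
  by rewrite !(JD, JZ) ME J1 -/S; ring.
have -> : \sum_k q k * (\sum_j p j * h j k ^+ 2 - B k ^+ 2) = S - b2.
  under eq_bigr do rewrite mulrBr; rewrite sumrB; congr (_ - _).
  rewrite /S /J exchange_big; apply: eq_bigr => k _; rewrite mulr_sumr.
  by apply: eq_bigr => j _; ring.
have -> : \sum_k p k * (\sum_j q j * h k j ^+ 2 - (\sum_j q j * h k j) ^+ 2)
    = S - a2.
  under eq_bigr do rewrite mulrBr; rewrite sumrB; congr (_ - _).
  rewrite /S /J; apply: eq_bigr => k _; rewrite mulr_sumr.
  by apply: eq_bigr => j _; ring.
have : 0 <= J (fun j k => (h j k - A j - B k + M) ^+ 2).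
  apply: sumr_ge0 => j _; apply: sumr_ge0 => k _.
  by rewrite mulr_ge0 ?sqr_ge0// mulr_ge0.
have -> : J (fun j k => (h j k - A j - B k + M) ^+ 2) =
    J (fun j k => h j k ^+ 2 + (A j * A j + (B k * B k + (M ^+ 2 * 1 +
      ((- 2) * (A j * h j k) + ((- 2) * (B k * h j k) + ((2 * M) * h j k +
      (2 * (A j * B k) + ((- 2 * M) * A j + (- 2 * M) * B k))))))))).
  by apply: eq_bigr => j _; apply: eq_bigr => k _; congr (_ * _); ring.
rewrite !(JD, JZ) JAA JBB JAh JBh JAB JA JB ME J1 -/S; nra.
Qed.

(** * Measurability and expectations of real functions *)

(** Nonnegativity of the weights makes the inverse of their sum a real power,
    whose measurability is known; a zero sum is harmless as [0^-1 = 0]. *)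
Lemma measurable_avg d (T : measurableType d) (R : realType) (I : finType)
    (w phi : I -> T -> R) :
  (forall i x, 0 <= w i x) ->
  (forall i, measurable_fun setT (w i)) ->
  (forall i, measurable_fun setT (phi i)) ->
  measurable_fun setT (fun x => avg (w ^~ x) (phi ^~ x)).
Proof.
move=> w0 mw mphi; rewrite /avg; apply: measurable_funM.
  by apply: measurable_sum => i; exact: measurable_funM.
under eq_fun do rewrite -powR_inv1 ?sumr_ge0//.
apply: (measurableT_comp (measurable_powR _)).
exact: measurable_sum.
Qed.

Lemma avgE (R : realType) (I : finType) (w phi : I -> R) :
  avg w phi = \sum_i (w i / \sum_j w j) * phi i.
Proof. by rewrite /avg mulr_suml; apply: eq_bigr => i _; rewrite mulrAC. Qed.

Section expectation_calculus.
Context d (T : measurableType d) (R : realType) (P : probability T R).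
Local Notation int X := (P.-integrable setT (EFin \o X)).

Lemma le_integrable_real (f g : T -> R) : measurable_fun setT f ->
  (forall x, `|f x| <= g x) -> int g -> int f.
Proof.
move=> mf fg; apply: le_integrable => //; first exact/measurable_EFinP.
by move=> x _; rewrite /= lee_fin (le_trans (fg x))// ler_norm.
Qed.

Lemma integrable_cst (r : R) : int (fun=> r).
Proof. exact: finite_measure_integrable_cst. Qed.

Lemma integrable_realD (f g : T -> R) :
  int f -> int g -> int (fun x => f x + g x).
Proof.
by move=> fi gi; apply: eq_integrable (integrableD measurableT fi gi).
Qed.

Lemma integrable_realB (f g : T -> R) :
  int f -> int g -> int (fun x => f x - g x).
Proof.
by move=> fi gi; apply: eq_integrable (integrableB measurableT fi gi).
Qed.

Lemma integrable_realZ (k : R) (f : T -> R) : int f -> int (fun x => k * f x).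
Proof. by move=> fi; apply: eq_integrable (integrableZl measurableT k fi). Qed.

Lemma integrable_norm (f : T -> R) : int f -> int (fun x => `|f x|).
Proof. by move=> fi; apply: eq_integrable (integrable_abse fi). Qed.

Lemma integrable_bounded (f : T -> R) (C : R) : measurable_fun setT f ->
  (forall x, `|f x| <= C) -> int f.
Proof.
move=> mf fC; apply: (@le_integrable_real _ (fun=> C)) => //.
exact: finite_measure_integrable_cst.
Qed.

Lemma integrable_real_sum (I : Type) (s : seq I) (X : I -> T -> R) :
  (forall i, int (X i)) -> int (fun w => \sum_(i <- s) X i w).
Proof.
move=> iX; rewrite (_ : _ \o _ = fun w => (\sum_(i <- s) (X i w)%:E)%E).
  by apply: integrable_sum => // i _; exact: iX.
by apply/funext => w /=; rewrite sumEFin.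
Qed.

Lemma Rintegral_sum (I : Type) (s : seq I) (X : I -> T -> R) :
  (forall i, int (X i)) ->
  \int[P]_w (\sum_(i <- s) X i w) = \sum_(i <- s) \int[P]_w X i w.
Proof.
move=> iX; elim: s => [|i s IH].
  under eq_Rintegral do rewrite big_nil.
  by rewrite big_nil Rintegral_cst// mul0r.
under eq_Rintegral do rewrite big_cons.
by rewrite big_cons RintegralD// ?IH//; exact: integrable_real_sum.
Qed.

Lemma integrableM_bounded (f g : T -> R) (C : R) : int f ->
  measurable_fun setT g -> (forall x, `|g x| <= C) -> int (f \* g).
Proof.
move=> fi mg gC.
have mf : measurable_fun setT f by exact/measurable_EFinP/(measurable_int P).
apply: (@le_integrable_real _ (fun x => C * `|f x|)).
- exact: measurable_funM.
- by move=> x; rewrite normrM mulrC ler_wpM2r.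
- exact/integrable_realZ/integrable_norm.
Qed.

End expectation_calculus.

(** * Independence *)

Section independent_product.
Context d (T : measurableType d) (R : realType) (P : probability T R).
Variables Y Z : {mfun T >-> R}.
Hypothesis YZ : forall A B : set R, measurable A -> measurable B ->
  P (Y @^-1` A `&` Z @^-1` B) = (P (Y @^-1` A) * P (Z @^-1` B))%E.
Hypotheses (iY : P.-integrable setT (EFin \o Y))
           (iZ : P.-integrable setT (EFin \o Z)).
Let W w := (Y w, Z w).
Let mW : measurable_fun setT W.
Proof. by apply/measurable_fun_pairP; split; exact: measurable_funPT. Qed.
HB.instance Definition _ := isMeasurableFun.Build _ _ _ _ W mW.

Let joint A : measurable A ->
  (distribution P Y \x distribution P Z)%E A = distribution P W A.
Proof. by move=> mA; apply: product_measure_unique => // A1 A2; exact: YZ. Qed.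

Let mulf (x : R * R) : \bar R := (x.1 * x.2)%:E.
Let mmulf : measurable_fun setT mulf.
Proof. by apply/measurable_EFinP; exact: measurable_funM. Qed.

Let mulf_integrable :
  (distribution P Y \x distribution P Z)%E.-integrable setT mulf.
Proof.
apply/integrable12ltyP => //.
have mabs : measurable_fun setT (fun y : R => `|y|%:E).
  by apply/measurable_EFinP.
have EZ : (\int[distribution P Z]_y `|y|%:E)%E = (\int[P]_w `|Z w|%:E)%E.
  by rewrite ge0_integral_distribution.
have EY : (\int[distribution P Y]_y `|y|%:E)%E = (\int[P]_w `|Y w|%:E)%E.
  by rewrite ge0_integral_distribution.
have {}EZ x : (\int[distribution P Z]_y `|mulf (x, y)|)%E =
    (`|x|%:E * \int[P]_w `|Z w|%:E)%E.
  rewrite -EZ -ge0_integralZl//.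
  by apply: eq_integral => y _; rewrite /mulf /= normrM EFinM.
under eq_integral do rewrite EZ.
rewrite ge0_integralZr//; last by apply: integral_ge0 => y _; rewrite lee_fin.
rewrite EY.
have [_ Yoo] := integrableP _ _ _ iY.
have [_ Zoo] := integrableP _ _ _ iZ.
by apply: lte_mul_pinfty => //;
  [exact: integral_ge0|rewrite ge0_fin_numE//; exact: integral_ge0].
Qed.

(** Independence identifies the joint law of [Y] and [Z] with the product of
    their laws, where Fubini's theorem factorises the integral. *)
Lemma integrable_independent_mul : P.-integrable setT (EFin \o (Y \* Z)).
Proof.
apply/integrableP; split; first exact/measurable_EFinP/measurable_funM.
have [_] := integrableP _ _ _ mulf_integrable.
rewrite (eq_measure_integral (distribution P W)); last first.
  by move=> A mA _; exact: joint.
rewrite ge0_integral_distribution//; exact: measurableT_comp.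
Qed.

Lemma Rintegral_independent_mul :
  \int[P]_w (Y w * Z w) = \int[P]_w Y w * \int[P]_w Z w.
Proof.
rewrite /Rintegral.
have -> : (\int[P]_w (Y w * Z w)%:E = \int[P]_w (mulf \o W) w)%E by [].
rewrite -integral_distribution//; last exact: integrable_independent_mul.
have -> : (\int[distribution P W]_x mulf x =
           \int[distribution P Y \x distribution P Z]_x mulf x)%E.
  by apply: eq_measure_integral => A mA _; rewrite [RHS]joint.
rewrite -integral12_prod_meas1// /fubini_F.
have mE : measurable_fun setT (@EFin R) by exact/measurable_EFinP.
have EZ : (\int[distribution P Z]_y y%:E)%E = (\int[P]_w (Z w)%:E)%E.
  by rewrite integral_distribution.
have EY : (\int[distribution P Y]_y y%:E)%E = (\int[P]_w (Y w)%:E)%E.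
  by rewrite integral_distribution.
have iiZ : (distribution P Z).-integrable setT (@EFin R).
  apply/integrableP; split => //.
  rewrite ge0_integral_distribution//; last exact: measurableT_comp.
  by have [_ +] := integrableP _ _ _ iZ.
have iiY : (distribution P Y).-integrable setT (@EFin R).
  apply/integrableP; split => //.
  rewrite ge0_integral_distribution//; last exact: measurableT_comp.
  by have [_ +] := integrableP _ _ _ iY.
have {}EZ x : (\int[distribution P Z]_y mulf (x, y))%E =
    (x%:E * \int[P]_w (Z w)%:E)%E.
  rewrite -EZ -integralZl//.
have fZ : (\int[P]_w (Z w)%:E)%E \is a fin_num by exact: integrable_fin_num.
have fY : (\int[P]_w (Y w)%:E)%E \is a fin_num by exact: integrable_fin_num.
transitivity (fine (\int[distribution P Y]_x
    (x%:E * (fine (\int[P]_w (Z w)%:E))%:E)))%E.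
  by congr fine; apply: eq_integral => x _; rewrite [LHS]EZ fineK.
by rewrite integralZr// EY -{1}(fineK fY).
Qed.

End independent_product.

Section leave_one_out.
Context d (T : measurableType d) (R : realType) (P : probability T R).
Variables (I : finType) (X : I -> {mfun T >-> R}) (F : set (set T)).
Hypotheses (sF : sigma_algebra setT F) (mF : F `<=` measurable).
Hypotheses (Xind : mutually_independent P X)
           (FX : sigma_independent P F (sigma_family X)).

(** All the randomness except that of [X i]. *)
Definition others_generator (i : I) : set (set T) :=
  F `|` \bigcup_(j in [set j | j != i]) g_sigma_algebra_preimage (X j).

Let SX j := g_sigma_algebra_preimage (X j).

Let SXI j : setI_closed (SX j).
Proof.
move=> _ _ [A mA <-] [B mB <-]; exists (A `&` B); first exact: measurableI.
by rewrite !setTI.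
Qed.

Let SXT j : SX j setT.
Proof. by exists setT => //; rewrite setTI preimage_setT. Qed.

Let SXm j : SX j `<=` measurable.
Proof. by move=> _ [B mB <-]; exact: measurable_funPT. Qed.

Let FT : F setT.
Proof. by have [F0 FC _] := sF; have := FC _ F0; rewrite setD0. Qed.

Let FI : setI_closed F.
Proof.
move=> A B FA FB; have [F0 FC FU] := sF.
have -> : A `&` B = setT `\` \bigcup_n (if n == 0%N then setT `\` A else setT `\` B).
  apply/seteqP; split => x /=.
    by move=> [Ax Bx]; split => // -[n _]; case: ifP => _ [].
  move=> [_ h]; split; apply: contrapT => nx; apply: h.
    by exists 0%N => //=; split.
  by exists 1%N => //=; split.
by apply: (FC); apply: FU => n; case: ifP => _; exact: FC.
Qed.

(** A pi-system whose sigma-algebra contains [others_generator i]. *)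
Let cyl i : set (set T) := [set B | exists M A, [/\ F M, forall j, SX j (A j) &
  B = M `&` \bigcap_(j in [set j | j != i]) A j]].

Let cylI i : setI_closed (cyl i).
Proof.
move=> _ _ [M [A [FM SA ->]]] [M' [A' [FM' SA' ->]]].
exists (M `&` M'), (fun j => A j `&` A' j); split.
- exact: FI.
- by move=> j; exact: SXI.
- by rewrite setIACA -bigcapI.
Qed.

Let cyl_gen i : <<s others_generator i >> `<=` <<s cyl i >>.
Proof.
apply: smallest_sub; first exact: smallest_sigma_algebra.
move=> B [FB|[j /= ji SB]]; apply: sub_sigma_algebra.
  exists B, (fun=> setT); split => //.
  by apply/seteqP; split => [x Bx|x []//]; split => // j _.
exists setT, (fun k => if k == j then B else setT); split => //.
  by move=> k; case: eqP => [->|].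
rewrite setTI; apply/seteqP; split => x.
  by move=> Bx k /= ki; case: eqP.
by move=> /(_ _ ji); rewrite eqxx.
Qed.

Let bigcapm i (A : I -> set T) : (forall j, SX j (A j)) ->
  measurable (\bigcap_(j in [set j | j != i]) A j).
Proof. by move=> SA; apply: fin_bigcap_measurable => [|j _];
  [exact: finite_finset|exact: SXm]. Qed.

Let cylm i : <<s cyl i >> `<=` measurable.
Proof.
apply: smallest_sub; first exact: sigma_algebra_measurable.
move=> _ [M [A [FM SA ->]]]; apply: measurableI; first exact: mF.
exact: bigcapm.
Qed.

Let cyl_indep i A B : SX i A -> cyl i B -> P (A `&` B) = (P A * P B)%E.
Proof.
move=> SA [M [D [FM SD ->]]].
pose D' := \bigcap_(j in [set j | j != i]) D j.
pose A' j := if j == i then A else D j.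
have SA' j : SX j (A' j) by rewrite /A'; case: eqP => // ->.
have AD : P (A `&` D') = (P A * P D')%E.
  have -> : A `&` D' = \bigcap_(j in [set` [set: I]%SET]) A' j.
    apply/seteqP; split => x /=.
      move=> [Ax Dx] j _; rewrite /A'; case: eqP => // /eqP ji; exact: Dx.
    move=> h; split; first by have := h i; rewrite /A' eqxx; apply; rewrite /= inE.
    by move=> j /= /negbTE ji; have := h j; rewrite /A' ji; apply; rewrite /= inE.
  have -> : D' = \bigcap_(j in [set` ([set: I] :\ i)%SET]) D j.
    by apply/seteqP; split => x h j /=; rewrite ?inE ?andbT => ji;
      apply: h; rewrite /= ?inE ?andbT.
  rewrite !Xind => [||j _]; [|by move=> j _; exact: SD|exact: SA'].
  rewrite (bigD1 i)/= ?inE// /A' eqxx; congr (_ * _)%E.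
  by apply: eq_big => j; [rewrite !inE andbT|move=> /andP[_ /negbTE ->]].
have famS A0 : (exists2 j, True & SX j A0) -> sigma_family X A0.
  by move=> [j _ SA0]; apply: (@sub_sigma_algebra _ _ (\bigcup_j SX j)); exists j.
have famm := @smallest_sigma_algebra T setT (\bigcup_j SX j).
have famI : setI_closed (sigma_family X).
  move=> U V HU HV.
  exact: (@measurableI _ (g_sigma_algebraType (\bigcup_j SX j))).
have famD : sigma_family X D'.
  apply: (@fin_bigcap_measurable _ (g_sigma_algebraType (\bigcup_j SX j))).
    exact: finite_finset.
  by move=> j _; apply: famS; exists j.
have famA : sigma_family X A by apply: famS; exists i.
by rewrite -/D' setICA (FX FM famD) (FX FM (famI _ _ famA famD)) AD muleCA.
Qed.

(** An event of [X i] factorises from an intersection of an event of [F] with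
    one event of each other variable: first split off [F], then use mutual
    independence twice. Such intersections form a pi-system, so Dynkin's lemma
    extends the factorisation to the sigma-algebra they generate. *)
Lemma leave_one_out_indep i A B : g_sigma_algebra_preimage (X i) A ->
  <<s others_generator i >> B -> P (A `&` B) = (P A * P B)%E.
Proof.
move=> SA /cyl_gen.
have mA : measurable A by exact: SXm SA.
apply: (@dynkin_induction _ (g_sigma_algebraType (cyl i)) (cyl i)
  [set B | P (A `&` B) = (P A * P B)%E]) => //=.
- by rewrite setIT probability_setT mule1.
- by move=> D; exact: cyl_indep.
- move=> D /cylm mD AD.
  rewrite -setDE measureD//; last first.
    by rewrite (le_lt_trans (probability_le1 _ _))// ltry.
  rewrite [X in (_ - X)%E]AD probability_setC// muleBr ?mule1//.
  by rewrite fin_num_measure.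
- move=> D mD tD AD.
  have mD' n : d.-measurable (D n) by exact: (cylm (mD n)).
  rewrite setI_bigcupr !measure_bigcup//; last 2 first.
  + by move=> n _; exact: measurableI.
  + by apply: trivIset_setIl.
  rewrite -(fineK (fin_num_measure P A mA)) -nneseriesZl//.
  by apply: eq_eseriesr => n _; rewrite fineK ?fin_num_measure// [LHS]AD.
Qed.

Lemma others_generator_measurable i : <<s others_generator i >> `<=` measurable.
Proof. by move=> A /cyl_gen /cylm. Qed.

End leave_one_out.

Section independent_of_sigma_algebra.
Context d (T : measurableType d) (R : realType) (P : probability T R).
Local Notation int X := (P.-integrable setT (EFin \o X)).
Variables (Y : {mfun T >-> R}) (G : set (set T)).
Hypothesis mG : <<s G >> `<=` measurable.
Hypothesis YG : forall A B, measurable A -> <<s G >> B ->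
  P (Y @^-1` A `&` B) = (P (Y @^-1` A) * P B)%E.

(** Measurability with respect to the sigma-algebra generated by [G]; in use,
    [G] generates all the randomness except [Y]. *)
Definition observable (Z : T -> R) :=
  measurable_fun (setT : set (g_sigma_algebraType G)) Z.

Lemma observable_measurable Z : observable Z -> measurable_fun setT Z.
Proof. by move=> mZ _ B mB; apply: mG; exact: mZ. Qed.

Lemma observable_indep (h : R -> R) (Z : T -> R) :
  measurable_fun setT h -> int (h \o Y) -> observable Z -> int Z ->
  int (fun x => h (Y x) * Z x) /\
  \int[P]_x (h (Y x) * Z x) = \int[P]_x h (Y x) * \int[P]_x Z x.
Proof.
move=> mh ihY oZ iZ.
have mhY : measurable_fun setT (h \o Y) by exact: measurableT_comp.
pose hY' := mfun_Sub (mem_set mhY) : {mfun T >-> R}.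
pose Z' := mfun_Sub (mem_set (observable_measurable oZ)) : {mfun T >-> R}.
have ind A B : measurable A -> measurable B ->
    P (hY' @^-1` A `&` Z' @^-1` B) = (P (hY' @^-1` A) * P (Z' @^-1` B))%E.
  move=> mA mB; rewrite /= comp_preimage; apply: YG.
    by rewrite -[X in measurable X]setTI; exact: mh.
  by have := oZ measurableT _ mB; rewrite setTI.
split.
  exact: (integrable_independent_mul ind ihY iZ).
exact: (Rintegral_independent_mul ind ihY iZ).
Qed.

End independent_of_sigma_algebra.

(** * Approximate integration by parts *)

Section approximate_integration_by_parts.
Context d (T : measurableType d) (R : realType) (P : probability T R).
Local Notation int X := (P.-integrable setT (EFin \o X)).
Variables (Y : {mfun T >-> R}) (G : set (set T)).
Hypothesis mG : <<s G >> `<=` measurable.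
Hypothesis YG : forall A B, measurable A -> <<s G >> B ->
  P (Y @^-1` A `&` B) = (P (Y @^-1` A) * P B)%E.
Hypotheses (iY2 : int (fun x => Y x ^+ 2)) (EY : \int[P]_x Y x = 0)
           (EY2 : \int[P]_x (Y x ^+ 2) = 1).

Let mY : measurable_fun setT Y. Proof. exact: measurable_funPT. Qed.

Lemma integrable_of_sqr : int Y.
Proof.
apply: (@le_integrable_real _ _ _ _ _ (fun x => 1 + Y x ^+ 2)) => //.
  by move=> x; rewrite -(real_normK (num_real (Y x))); nra.
by apply: integrable_realD iY2; exact: integrable_cst.
Qed.
Let iY := integrable_of_sqr.

Lemma Rintegral_norm_le1 : \int[P]_x `|Y x| <= 1.
Proof.
have -> : 1 = \int[P]_x (2^-1 + 2^-1 * Y x ^+ 2) :> R.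
  rewrite RintegralD//; first last.
  - exact: integrable_realZ.
  - exact: integrable_cst.
  rewrite RintegralZl// EY2 Rintegral_cst// [X in fine X]probability_setT/=; lra.
apply: le_Rintegral => //.
- exact: integrable_norm.
- by apply: integrable_realD; [exact: integrable_cst|exact: integrable_realZ].
- move=> x _; rewrite -(real_normK (num_real (Y x))).
  by have := sqr_ge0 (`|Y x| - 1); nra.
Qed.

Variables (I : finType) (a : I -> R) (w phi : I -> T -> R) (c : R).
Hypotheses (c0 : 0 <= c) (a1 : forall i, `|a i| <= 1)
  (w0 : forall i x, 0 <= w i x) (W0 : forall x, 0 < \sum_i w i x)
  (phi1 : forall i x, `|phi i x| <= 1)
  (ow : forall i, observable G (w i)) (ophi : forall i, observable G (phi i)).

Let F s x := tilted_avg (w ^~ x) a c (phi ^~ x) s.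
Let D s x := tilted_cov (w ^~ x) a c (phi ^~ x) s.

Lemma measurable_tilted_avg d' (T' : measurableType d') (S : T' -> R)
    (u psi : I -> T' -> R) :
  (forall i x, 0 <= u i x) -> (forall i, measurable_fun setT (u i)) ->
  measurable_fun setT S -> (forall i, measurable_fun setT (psi i)) ->
  measurable_fun setT (fun x => tilted_avg (u ^~ x) a c (psi ^~ x) (S x)).
Proof.
move=> u0 mu mS mpsi.
apply: (@measurable_avg _ _ _ _ (fun i x => tilt (u ^~ x) a c (S x) i)) => //.
  by move=> i x; exact: tilt_ge0.
move=> i; apply: measurable_funM => //.
apply: (measurableT_comp (@measurable_expR R)).
exact: measurable_funM.
Qed.

Lemma measurable_tilted_cov d' (T' : measurableType d') (S : T' -> R)
    (u psi : I -> T' -> R) :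
  (forall i x, 0 <= u i x) -> (forall i, measurable_fun setT (u i)) ->
  measurable_fun setT S -> (forall i, measurable_fun setT (psi i)) ->
  measurable_fun setT (fun x => tilted_cov (u ^~ x) a c (psi ^~ x) (S x)).
Proof.
move=> u0 mu mS mpsi; apply: measurable_funM => //.
apply: measurable_funB; last first.
  by apply: measurable_funM; [exact: measurable_tilted_avg|
    exact: (@measurable_tilted_avg _ _ _ u (fun i _ => a i))].
by apply: (@measurable_tilted_avg _ _ _ u (fun i x => psi i x * a i)) => // i;
  exact: measurable_funM.
Qed.

Let obs_measurable (Z : T -> R) (oZ : observable G Z) := observable_measurable mG oZ.

Let mF : measurable_fun setT (fun x => F (Y x) x).
Proof. by apply: measurable_tilted_avg => // i; exact: obs_measurable. Qed.

Let mD : measurable_fun setT (fun x => D (Y x) x).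
Proof. by apply: measurable_tilted_cov => // i; exact: obs_measurable. Qed.

Let oF0 : observable G (F 0).
Proof. exact: measurable_tilted_avg. Qed.

Let oD0 : observable G (D 0).
Proof. exact: measurable_tilted_cov. Qed.

Let F1 s x : `|F s x| <= 1. Proof. exact: tilted_avg_norm_le1. Qed.
Let Dle s x : `|D s x| <= 2 * c. Proof. exact: tilted_cov_norm_le. Qed.

Let iF0 : int (F 0).
Proof. by apply: (@integrable_bounded _ _ _ _ _ 1) => //; exact: obs_measurable. Qed.
Let iD0 : int (D 0).
Proof.
by apply: (@integrable_bounded _ _ _ _ _ (2 * c)) => //; exact: obs_measurable.
Qed.
Lemma integrable_tilted_cov : int (fun x => D (Y x) x).
Proof. exact: (@integrable_bounded _ _ _ _ _ (2 * c)). Qed.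
Lemma integrable_mul_tilted_avg : int (fun x => Y x * F (Y x) x).
Proof. exact: (integrableM_bounded iY mF). Qed.

(** Bounds [s] times the remainder in [tilted_avg_taylor], divided by [c]. *)
Definition taylor_error (s : R) :=
  `|s| * Num.min (4 * `|s|) (6 * c * `|s| ^+ 2).

Lemma integrable_taylor_error : int (taylor_error \o Y).
Proof.
apply: (@le_integrable_real _ _ _ _ _ (fun x => 4 * Y x ^+ 2)); last first.
- exact: integrable_realZ.
- move=> x /=; rewrite /taylor_error -(real_normK (num_real (Y x))).
  have y0 := normr_ge0 (Y x); set y := `|Y x| in y0 *.
  have m0 : 0 <= Num.min (4 * y) (6 * c * y ^+ 2).
    by rewrite le_min !mulr_ge0// ?sqr_ge0.
  rewrite ger0_norm ?mulr_ge0//.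
  rewrite (_ : 4 * y ^+ 2 = y * (4 * y)); last by ring.
  by rewrite ler_wpM2l// ge_min lexx.
- apply: measurable_funM => /=; first exact: measurableT_comp.
  apply: measurable_minr; apply: measurable_funM => //.
    exact: measurableT_comp.
  by apply: measurable_funX; exact: measurableT_comp.
Qed.

(** For a Gaussian [Y] the expectations of [Y F(Y)] and of [F'(Y)] agree. In
    general, expand [F] at 0: since [F(0)] and [F'(0)] are independent of [Y],
    [Y F(0)] has mean zero and [Y ^+ 2 F'(0)] has the mean of [F'(0)]. Hence
    [Y F(Y)] has the mean of [F'(0)] up to the Taylor error, and replacing
    [F'(0)] by [F'(Y)] costs the Lipschitz constant times the mean of [`|Y|],
    which is at most 1. *)
Lemma approximate_integration_by_parts :
  \int[P]_x D (Y x) x <= \int[P]_x (Y x * F (Y x) x)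
    + c * \int[P]_x taylor_error (Y x) + 6 * c ^+ 2.
Proof.
have mid : measurable_fun setT (fun y : R => y) by [].
have [iYF YF] := observable_indep mG YG mid iY oF0 iF0.
have mX : measurable_fun setT (fun y : R => y ^+ 2) by exact: measurable_funX.
have [iYD YD] := observable_indep mG YG mX iY2 oD0 iD0.
have {}YF : \int[P]_x (Y x * F 0 x) = 0 by rewrite YF EY mul0r.
have {}YD : \int[P]_x (Y x ^+ 2 * D 0 x) = \int[P]_x D 0 x.
  by rewrite YD EY2 mul1r.
have ie := integrable_taylor_error.
have iabs : int (fun x => `|Y x|) by exact: integrable_norm.
have h1 : \int[P]_x D 0 x - c * \int[P]_x taylor_error (Y x)
    <= \int[P]_x (Y x * F (Y x) x).
  have -> : \int[P]_x D 0 x - c * \int[P]_x taylor_error (Y x) =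
      \int[P]_x (Y x * F 0 x + Y x ^+ 2 * D 0 x - c * taylor_error (Y x)).
    rewrite RintegralB//; last 2 first.
    - exact: (integrable_realD iYF iYD).
    - exact: integrable_realZ.
    by rewrite RintegralD// RintegralZl// YF YD add0r.
  apply: le_Rintegral => //.
  - apply: integrable_realB; first exact: (integrable_realD iYF iYD).
    exact: integrable_realZ.
  - exact: integrable_mul_tilted_avg.
  - move=> x _.
    have := tilted_avg_taylor (w0 ^~ x) (W0 x) c0 a1 (phi1 ^~ x) (Y x).
    rewrite -/(F _ _) -/(F _ _) -/(D _ _) => tay.
    have : `|Y x * (F (Y x) x - F 0 x - D 0 x * Y x)| <= c * taylor_error (Y x).
      by rewrite normrM /taylor_error mulrCA ler_wpM2l.
    by rewrite ler_norml => /andP[+ _]; lra.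
have h2 : \int[P]_x D (Y x) x <= \int[P]_x D 0 x + 6 * c ^+ 2.
  apply: (@le_trans _ _ (\int[P]_x (D 0 x + 6 * c ^+ 2 * `|Y x|))).
    apply: le_Rintegral => //.
    - exact: integrable_tilted_cov.
    - by apply: (integrable_realD iD0); exact: integrable_realZ.
    - move=> x _.
      have := tilted_cov_lip (w0 ^~ x) (W0 x) c0 a1 (phi1 ^~ x) (Y x).
      by rewrite -/(D _ _) -/(D _ _) ler_norml => /andP[_]; rewrite lerBlDl.
  rewrite RintegralD//; last exact: integrable_realZ.
  rewrite RintegralZl// lerD2l -[leRHS]mulr1 ler_wpM2l//.
    by rewrite mulr_ge0 ?sqr_ge0.
  exact: Rintegral_norm_le1.
lra.
Qed.

End approximate_integration_by_parts.

(** * The mean conditional variance of the overlap *)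

Section conditional_variance.
Context d (T : measurableType d) (R : realType) (P : probability T R).
Local Notation int X := (P.-integrable setT (EFin \o X)).
Variables (E I K : finType) (Y : E -> {mfun T >-> R}) (G : E -> set (set T)).
Hypothesis mG : forall e, <<s G e >> `<=` measurable.
Hypothesis YG : forall e A B, measurable A -> <<s G e >> B ->
  P (Y e @^-1` A `&` B) = (P (Y e @^-1` A) * P B)%E.
Hypotheses (iY2 : forall e, int (fun x => Y e x ^+ 2))
  (EY : forall e, \int[P]_x Y e x = 0)
  (EY2 : forall e, \int[P]_x (Y e x ^+ 2) = 1).
Hypothesis oY : forall e e', e' != e -> observable (G e) (Y e').
Variables (a : E -> I -> R) (b : E -> K -> R).
Hypotheses (a1 : forall e j, `|a e j| <= 1) (b1 : forall e k, `|b e k| <= 1).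
Variables (v : I -> T -> R) (q : K -> T -> R) (c : R).
Hypotheses (c0 : 0 < c) (v0 : forall j x, 0 <= v j x)
  (V0 : forall x, 0 < \sum_j v j x)
  (q0 : forall k x, 0 <= q k x) (q1 : forall x, \sum_k q k x = 1)
  (ov : forall e j, observable (G e) (v j))
  (oq : forall e k, observable (G e) (q k)).

(** The overlap of a configuration of level [j] with one of level [k]. *)
Definition mean_product (j : I) (k : K) : R :=
  #|E|%:R^-1 * \sum_e a e j * b e k.

(** Gibbs weights on the side driven by [Y]: [v] collects the reference measure
    and the part of the Hamiltonian without [Y], while [q] is the law of the
    opposite side. *)
Definition exp_weight (j : I) (x : T) :=
  v j x * expR (\sum_e Y e x * (c * a e j)).

Definition exp_prob j x := exp_weight j x / \sum_i exp_weight i x.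

Let Q := mean_product.
Let p := exp_prob.
Let N : R := #|E|%:R.

Let N0 : 0 <= N. Proof. by []. Qed.

Lemma mean_product_le1 j k : `|Q j k| <= 1.
Proof.
rewrite /Q /mean_product -/N normrM normfV (ger0_norm N0).
have [N0'|N0'] := eqVneq N 0; first by rewrite N0' invr0 mul0r.
rewrite mulrC ler_pdivrMr ?lt_def ?N0' ?N0// mul1r.
apply: le_trans (ler_norm_sum _ _ _) _.
rewrite /N -sum1_card natr_sum; apply: ler_sum => e _.
exact: norm_mul_le1.
Qed.

Lemma exp_weight_ge0 j x : 0 <= exp_weight j x.
Proof. by rewrite mulr_ge0 ?expR_ge0. Qed.

Lemma exp_weight_sum_gt0 x : 0 < \sum_j exp_weight j x.
Proof. exact: (sum_exp_gt0 _ (v0 ^~ x) (V0 x)). Qed.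

Lemma exp_prob_ge0 j x : 0 <= p j x.
Proof. by rewrite divr_ge0 ?exp_weight_ge0// ltW// exp_weight_sum_gt0. Qed.

Lemma exp_prob_sum x : \sum_j p j x = 1.
Proof. by rewrite -mulr_suml divff// gt_eqF// exp_weight_sum_gt0. Qed.

(** Leaving [Y e] out of the weights makes them independent of [Y e]; the tilt
    by [Y e] puts it back, see [tiltE]. *)
Let w e j x := v j x * expR (\sum_(e' | e' != e) Y e' x * (c * a e' j)).
(** The factor [b e k] makes the covariances with [a e] add up, over [e], to
    conditional variances of the overlap; see [mean_D]. *)
Let phi e j x := \sum_k q k x * (b e k * Q j k).

Let w0 e j x : 0 <= w e j x. Proof. by rewrite mulr_ge0 ?expR_ge0. Qed.

Let W0 e x : 0 < \sum_j w e j x.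
Proof. exact: (sum_exp_gt0 _ (v0 ^~ x) (V0 x)). Qed.

Let ow e j : observable (G e) (w e j).
Proof.
apply: measurable_funM; first exact: ov.
apply: (measurableT_comp (@measurable_expR R)).
under eq_fun do rewrite big_mkcond.
apply: measurable_sum => e'; have [->|e'e]/= := eqVneq e' e; first by [].
by apply: measurable_funM => //; exact: oY.
Qed.

Let ophi e j : observable (G e) (phi e j).
Proof.
by apply: measurable_sum => k; apply: measurable_funM => //; exact: oq.
Qed.

Let phi1 e j x : `|phi e j x| <= 1.
Proof.
apply: le_trans (ler_norm_sum _ _ _) _; rewrite -(q1 x).
apply: ler_sum => k _; rewrite normrM (ger0_norm (q0 _ _)) ler_piMr//.
by apply: norm_mul_le1 => //; exact: mean_product_le1.
Qed.

Let tiltE e x : tilt (w e ^~ x) (a e) c (Y e x) = exp_weight ^~ x.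
Proof.
apply/funext => j; rewrite /tilt /w /exp_weight -mulrA -expRD.
by rewrite [in RHS](bigD1 e)//= addrC.
Qed.

Let tavgE e (psi : I -> R) x :
  tilted_avg (w e ^~ x) (a e) c psi (Y e x) = \sum_j p j x * psi j.
Proof. by rewrite /tilted_avg tiltE avgE. Qed.

Let F e x := tilted_avg (w e ^~ x) (a e) c (phi e ^~ x) (Y e x).
Let D e x := tilted_cov (w e ^~ x) (a e) c (phi e ^~ x) (Y e x).

(** Summing over [e] turns [a e j * b e k] into the overlap. *)
Let mean_D x : N^-1 * \sum_e D e x = c * mean_cond_var (p ^~ x) (q ^~ x) Q.
Proof.
transitivity (c * (N^-1 * \sum_e \sum_k q k x *
    (\sum_j p j x * ((b e k * a e j) * Q j k) -
     (\sum_j p j x * Q j k) * (\sum_j p j x * (b e k * a e j))))).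
  rewrite mulrCA; congr (_ * _); rewrite mulr_sumr; apply: eq_bigr => e _.
  rewrite /D /tilted_cov !tavgE; congr (c * _).
  under eq_bigr do rewrite /phi mulr_suml mulr_sumr.
  under [X in _ - X * _]eq_bigr do rewrite /phi mulr_sumr.
  rewrite exchange_big/= [X in _ - X * _]exchange_big/= mulr_suml -sumrB.
  apply: eq_bigr => k _; rewrite mulrBr; congr (_ - _).
    by rewrite mulr_sumr; apply: eq_bigr => j _; ring.
  have -> : \sum_j p j x * (b e k * a e j) = b e k * \sum_j p j x * a e j.
    by rewrite mulr_sumr; apply: eq_bigr => j _; ring.
  have -> : \sum_j p j x * (q k x * (b e k * Q j k)) =
      q k x * b e k * \sum_j p j x * Q j k.
    by rewrite mulr_sumr; apply: eq_bigr => j _; ring.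
  ring.
congr (c * _); rewrite /mean_cond_var exchange_big mulr_sumr/=.
apply: eq_bigr => k _; rewrite -mulr_sumr mulrCA; congr (_ * _).
rewrite sumrB mulrBr -mulr_sumr expr2 mulrCA exchange_big/=.
congr (_ - _ * _).
  rewrite mulr_sumr; apply: eq_bigr => j _.
  have -> : \sum_e p j x * (b e k * a e j * Q j k) =
      p j x * Q j k * \sum_e a e j * b e k.
    by rewrite mulr_sumr; apply: eq_bigr => e _; ring.
  by rewrite mulrCA -mulrA expr2.
rewrite exchange_big mulr_sumr; apply: eq_bigr => j _ /=.
have -> : \sum_e p j x * (b e k * a e j) = p j x * \sum_e a e j * b e k.
  by rewrite mulr_sumr; apply: eq_bigr => e _; ring.
by rewrite mulrCA.
Qed.

Let L k x := N^-1 * \sum_e Y e x * b e k.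

Let mean_YF x : N^-1 * \sum_e Y e x * F e x =
  \sum_k q k x * (L k x * \sum_j p j x * Q j k).
Proof.
transitivity (N^-1 * \sum_e \sum_k q k x *
    (Y e x * b e k * \sum_j p j x * Q j k)).
  congr (_ * _); apply: eq_bigr => e _; rewrite /F tavgE /phi mulr_sumr.
  under eq_bigr do rewrite mulr_sumr mulr_sumr.
  rewrite exchange_big/=; apply: eq_bigr => k _.
  by rewrite !mulr_sumr; apply: eq_bigr => j _; ring.
rewrite exchange_big mulr_sumr/=; apply: eq_bigr => k _.
by rewrite -mulr_sumr mulrCA -mulr_suml /L -mulrA.
Qed.

Let L2 x := \sum_k q k x * L k x ^+ 2.

(** The overlap is at most 1, and [`|l|] is split by the inequality
    [2 * `|l| <= r * l ^+ 2 + r^-1]; the choice [r = Num.sqrt N] balances the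
    two terms, as [L2] has mean at most [N^-1]. *)
Let mean_YF_le x :
  N^-1 * \sum_e Y e x * F e x <= 2^-1 * (Num.sqrt N * L2 x + (Num.sqrt N)^-1).
Proof.
rewrite mean_YF.
have -> : 2^-1 * (Num.sqrt N * L2 x + (Num.sqrt N)^-1) =
    \sum_k q k x * (2^-1 * (Num.sqrt N * L k x ^+ 2 + (Num.sqrt N)^-1)).
  rewrite -[X in _ + X]mul1r -(q1 x) /L2 mulr_sumr mulr_suml -big_split/=.
  by rewrite mulr_sumr; apply: eq_bigr => k _; ring.
apply: ler_sum => k _; apply: ler_wpM2l => //.
set B := \sum_j _; set l := L k x; set r := Num.sqrt N.
have B1 : `|B| <= 1.
  apply: le_trans (ler_norm_sum _ _ _) _; rewrite -(exp_prob_sum x).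
  apply: ler_sum => j _; rewrite normrM (ger0_norm (exp_prob_ge0 _ _)).
  by rewrite ler_piMr ?exp_prob_ge0//; exact: mean_product_le1.
apply: (@le_trans _ _ `|l|).
  apply: le_trans (ler_norm _) _; rewrite normrM ler_piMr//.
have [r0|r0] := eqVneq r 0.
  have N0' : N = 0.
    by apply/eqP; move/eqP: r0; rewrite sqrtr_eq0 => N_le0; rewrite eq_le N_le0.
  by rewrite /l /L N0' r0 invr0 !mul0r normr0 addr0 mulr0.
have r_gt0 : 0 < r by rewrite lt_def r0 sqrtr_ge0.
have -> : 2^-1 * (r * l ^+ 2 + r^-1) = `|l| + (2 * r)^-1 * (r * `|l| - 1) ^+ 2.
  by rewrite -(real_normK (num_real l)); field.
by rewrite lerDl mulr_ge0 ?sqr_ge0// invr_ge0 mulr_ge0// ltW.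
Qed.

Let iY e : int (Y e). Proof. exact: integrable_of_sqr. Qed.

Let q_le1 k x : `|q k x| <= 1.
Proof.
by rewrite ger0_norm// -(q1 x) (bigD1 k)//= lerDl sumr_ge0.
Qed.

Let mq (e : E) k : measurable_fun setT (q k).
Proof. exact: (observable_measurable (@mG e) (@oq e k)). Qed.

Let iq (e : E) k : int (q k).
Proof. exact: (integrable_bounded P (@mq e k) (@q_le1 k)). Qed.

(** The law [q] does not see [Y], so the variables stay orthonormal under it. *)
Let YYq e e' k : int (fun x => Y e x * (Y e' x * q k x)) /\
  \int[P]_x (Y e x * (Y e' x * q k x)) = (e == e')%:R * \int[P]_x q k x.
Proof.
have [<-|ee'] := eqVneq e e'.
  have mX : measurable_fun setT (fun y : R => y ^+ 2) by exact: measurable_funX.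
  have [i1 i2] := observable_indep (@mG e) (@YG e) mX (@iY2 e) (@oq e k) (@iq e k).
  have E' : (fun x => Y e x ^+ 2 * q k x) = (fun x => Y e x * (Y e x * q k x)).
    by apply/funext => x; rewrite expr2 mulrA.
  by rewrite -E'; split => //; rewrite i2 EY2.
have mid : measurable_fun setT (fun y : R => y) by [].
have e'e : e' != e by rewrite eq_sym.
have oYq : observable (G e) (fun x => Y e' x * q k x).
  by apply: measurable_funM; [exact: oY|exact: oq].
have iYq := integrableM_bounded (@iY e') (@mq e k) (@q_le1 k).
have [i1 i2] := observable_indep (@mG e) (@YG e) mid (iY e) oYq iYq.
by split => //; rewrite i2 EY !mul0r.
Qed.

Let L2E x : L2 x = N^-1 ^+ 2 * \sum_e \sum_e' \sum_k
  (b e k * b e' k) * (Y e x * (Y e' x * q k x)).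
Proof.
rewrite /L2.
have -> : \sum_e \sum_e' \sum_k (b e k * b e' k) * (Y e x * (Y e' x * q k x)) =
  \sum_k q k x * ((\sum_e Y e x * b e k) * (\sum_e Y e x * b e k)).
  under eq_bigr do rewrite exchange_big.
  rewrite exchange_big/=; apply: eq_bigr => k _.
  rewrite mulr_suml mulr_sumr; apply: eq_bigr => e _.
  by rewrite mulr_sumr mulr_sumr; apply: eq_bigr => e' _; ring.
by rewrite mulr_sumr; apply: eq_bigr => k _; rewrite /L; ring.
Qed.

Let iL2 : int L2.
Proof.
rewrite (funext L2E).
apply: integrable_realZ; apply: integrable_real_sum => e.
apply: integrable_real_sum => e'; apply: integrable_real_sum => k.
by apply: integrable_realZ; have [] := YYq e e' k.
Qed.

Let EL2 : \int[P]_x L2 x <= N^-1.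
Proof.
have i1 e e' k : int (fun x => (b e k * b e' k) * (Y e x * (Y e' x * q k x))).
  by apply: integrable_realZ; have [] := YYq e e' k.
have i2 e e' := integrable_real_sum (index_enum K) (i1 e e').
have i3 e := integrable_real_sum (index_enum E) (i2 e).
have i4 := integrable_real_sum (index_enum E) i3.
under eq_Rintegral do rewrite L2E.
rewrite RintegralZl// Rintegral_sum//.
apply: (@le_trans _ _ (N^-1 ^+ 2 * N)); last first.
  have [->|n0] := eqVneq N 0; first by rewrite invr0 mulr0.
  by rewrite expr2 mulfVK.
have NE : N = \sum_(e : E) 1 by rewrite /N -sum1_card natr_sum.
rewrite ler_wpM2l ?sqr_ge0// NE; apply: ler_sum => e _.
rewrite Rintegral_sum// (bigD1 e)//= [X in _ + X]big1 ?addr0; last first.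
  move=> e' e'e; rewrite Rintegral_sum// big1// => k _.
  have [iYY YY] := YYq e e' k.
  by rewrite RintegralZl// YY eq_sym (negbTE e'e) mul0r mulr0.
rewrite Rintegral_sum//.
have -> : 1 = \int[P]_x (\sum_k q k x).
  under eq_Rintegral do rewrite q1.
  by rewrite Rintegral_cst// [X in fine X]probability_setT mulr1.
rewrite Rintegral_sum; last by move=> k; exact: iq.
apply: ler_sum => k _; have [iYY YY] := YYq e e k.
rewrite RintegralZl// YY eqxx mul1r ler_piMl//; last first.
  by apply: (le_trans (ler_norm _)); exact: norm_mul_le1.
by apply: Rintegral_ge0.
Qed.

Let iD e : int (D e).
Proof.
exact: (integrable_tilted_cov P (Y e) (@mG e) (ltW c0) (@a1 e) (@w0 e)
  (@phi1 e) (@ow e) (@ophi e)).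
Qed.

Let mean_cond_varE x : mean_cond_var (p ^~ x) (q ^~ x) Q =
  c^-1 * (N^-1 * \sum_e D e x).
Proof. by rewrite mean_D mulKf// gt_eqF. Qed.

Lemma integrable_mean_cond_var :
  int (fun x => mean_cond_var (p ^~ x) (q ^~ x) Q).
Proof.
rewrite (funext mean_cond_varE).
by apply/integrable_realZ/integrable_realZ/integrable_real_sum.
Qed.

(** By [mean_D] the conditional variance is a mean of derivatives in the [Y e].
    Approximate integration by parts trades these for [Y e] times the averages;
    the mean over [e] of the latter is an integral against [q] of the overlap
    times [L], and [L] is small because it is a mean of uncorrelated variables
    that are independent of [q]. *)
Lemma mean_cond_var_le :
  \int[P]_x mean_cond_var (p ^~ x) (q ^~ x) Q <=
  (c * Num.sqrt N)^-1 + N^-1 * \sum_e (\int[P]_x taylor_error c (Y e x) + 6 * c).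
Proof.
have iYF e : int (fun x => Y e x * F e x).
  exact: (integrable_mul_tilted_avg (@mG e) (@iY2 e) (a e) c (@w0 e) (@phi1 e)
    (@ow e) (@ophi e)).
have ED : \int[P]_x mean_cond_var (p ^~ x) (q ^~ x) Q =
    c^-1 * (N^-1 * \sum_e \int[P]_x D e x).
  rewrite -Rintegral_sum// -!RintegralZl//; first last.
  - exact: integrable_real_sum.
  - exact/integrable_realZ/integrable_real_sum.
  by apply: eq_Rintegral => x _; rewrite mean_cond_varE.
have EYF : N^-1 * \sum_e \int[P]_x (Y e x * F e x) <= (Num.sqrt N)^-1.
  have -> : N^-1 * \sum_e \int[P]_x (Y e x * F e x) =
      \int[P]_x (N^-1 * \sum_e Y e x * F e x).
    by rewrite RintegralZl ?Rintegral_sum//; exact: integrable_real_sum.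
  apply: (@le_trans _ _ (\int[P]_x
      (2^-1 * (Num.sqrt N * L2 x + (Num.sqrt N)^-1)))).
    apply: le_Rintegral => //.
    - exact/integrable_realZ/integrable_real_sum.
    - apply: integrable_realZ; apply: integrable_realD.
        exact: integrable_realZ.
      exact: integrable_cst.
  rewrite RintegralZl//; last first.
    apply: integrable_realD; first exact: integrable_realZ.
    exact: integrable_cst.
  rewrite RintegralD//; [|exact: integrable_realZ|exact: integrable_cst].
  rewrite RintegralZl// Rintegral_cst// [X in fine X]probability_setT mulr1.
  have : Num.sqrt N * \int[P]_x L2 x <= (Num.sqrt N)^-1.
    apply: le_trans (ler_wpM2l (sqrtr_ge0 _) EL2) _.
    have [->|n0] := eqVneq N 0; first by rewrite invr0 mulr0 invr_ge0.
    rewrite -{2}(sqr_sqrtr N0) expr2 invfM mulrA divff ?mul1r//.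
    by rewrite sqrtr_eq0 -ltNge lt_def n0.
  lra.
rewrite ED.
have S : \sum_e \int[P]_x D e x <= \sum_e \int[P]_x (Y e x * F e x) +
    c * \sum_e (\int[P]_x taylor_error c (Y e x) + 6 * c).
  rewrite mulr_sumr -big_split/=; apply: ler_sum => e _.
  have := approximate_integration_by_parts (@mG e) (@YG e) (@iY2 e) (@EY e)
    (@EY2 e) (ltW c0) (@a1 e) (@w0 e) (@W0 e) (@phi1 e) (@ow e) (@ophi e).
  by rewrite -/(D e _) -/(F e _); lra.
have Ni : 0 <= N^-1 by rewrite invr_ge0.
have := ler_wpM2l Ni S; rewrite mulrDr => S'.
rewrite mulrC ler_pdivrMr// mulrDl invfM mulrAC mulVf ?mul1r ?gt_eqF//.
apply: le_trans S' _; apply: lerD => //.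
by rewrite mulrCA mulrC.
Qed.

End conditional_variance.

(** * Gibbs measures on finitely many levels *)

Section weighted_measure.
Local Open Scope ereal_scope.
Context d (S : measurableType d) (R : realType).
Variables (mu : {measure set S -> \bar R}) (g : {mfun S >-> R}).

Definition exp_measure (A : set S) := \int[mu]_(x in A) (expR (g x))%:E.

Let exp_measure0 : exp_measure set0 = 0. Proof. exact: integral_set0. Qed.

Let exp_measure_ge0 A : 0 <= exp_measure A.
Proof. by apply: integral_ge0 => x _; rewrite lee_fin expR_ge0. Qed.

Let exp_measure_sigma_additive : semi_sigma_additive exp_measure.
Proof.
apply: semi_sigma_additive_nng_induced; last first.
  by move=> x; rewrite lee_fin expR_ge0.
by apply/measurable_EFinP; exact: measurableT_comp.
Qed.

HB.instance Definition _ := isMeasure.Build _ _ _ exp_measure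
  exp_measure0 exp_measure_ge0 exp_measure_sigma_additive.

Lemma gibbs_is_probability : 0 < exp_measure setT < +oo ->
  exists G : probability S R, (G : set S -> \bar R) = gibbs mu g.
Proof.
move=> /andP[Z0 Zoo].
(* The Dirac mass stands in when the total mass is 0 or infinite only. *)
exists (mnormalize exp_measure (dirac point)).
apply/funext => A; rewrite /= /mnormalize gt_eqF// lt_eqF//=.
by rewrite muleC.
Qed.

End weighted_measure.

(** The index set consists of the joint values of the family [f]. Points cannot
    be used instead, because singletons of [S] need not be measurable. *)
Lemma finite_levels d (S : measurableType d) (R : realType) (E : finType)
    (f : E -> {mfun S >-> R}) : finite_set [set: S] ->
  exists (I : finType) (idx : S -> I) (a : E -> I -> R),
    [/\ forall i, measurable (idx @^-1` [set i]),
        forall e x, f e x = a e (idx x) &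
        forall i, exists x, idx x = i].
Proof.
move=> /finite_seqP[s Ss].
pose code x : {ffun E -> R} := [ffun e => f e x].
pose r := [seq code x | x <- s].
have codeP x : code x \in r.
  by apply: map_f; have : [set: S] x by []; rewrite Ss.
exists (seq_sub r), (fun x => SeqSub (codeP x)),
  (fun e i => (ssval i : {ffun E -> R}) e); split.
- move=> i.
  have -> : (fun x => SeqSub (codeP x)) @^-1` [set i] =
      \bigcap_(e in [set: E]) f e @^-1` [set (ssval i : {ffun E -> R}) e].
    apply/seteqP; split => x /=.
      by move=> <- e _ /=; rewrite ffunE.
    by move=> h; apply/val_inj/ffunP => e /=; rewrite ffunE; exact: h.
  apply: fin_bigcap_measurable => [|e _]; first exact: finite_finset.
  exact: measurable_funPTI.
- by move=> e x /=; rewrite ffunE.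
- move=> [i ir]; have /mapP[x xs ix] := ir.
  by exists x; apply: val_inj; rewrite /= ix.
Qed.

Section levels.
Context d (S : measurableType d) (R : realType) (I : finType) (idx : S -> I).
Hypothesis midx : forall i, measurable (idx @^-1` [set i]).

Let lev i := idx @^-1` [set i].
Let mlev i : measurable (lev i). Proof. exact: midx. Qed.

Lemma measurable_level_fun (g : I -> R) : measurable_fun setT (fun x => g (idx x)).
Proof.
move=> _ B mB; rewrite setTI.
have -> : (fun x => g (idx x)) @^-1` B = \bigcup_(i in [set i | B (g i)]) lev i.
  apply/seteqP; split => [x Bx|x [i Bi ix]]; first by exists (idx x).
  by rewrite /= (ix : idx x = i).
by apply: fin_bigcup_measurable => [|i _]; [exact: finite_finset|exact: midx].
Qed.

Lemma integral_levels (m : {measure set S -> \bar R}) (g : I -> R) :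
  (m setT < +oo)%E ->
  (\int[m]_x (g (idx x))%:E)%E = (\sum_i g i * fine (m (lev i)))%:E.
Proof.
move=> moo.
have mfin A : measurable A -> m A \is a fin_num.
  move=> mA; rewrite ge0_fin_numE//; apply: le_lt_trans moo.
  by apply: le_measure => //; rewrite inE.
transitivity (\int[m]_x (\sum_i (g i)%:E * (\1_(lev i) x)%:E))%E.
  apply: eq_integral => x _; rewrite (bigD1 (idx x))//= big1 ?adde0; last first.
    move=> i ix; rewrite indicE memNset ?mule0//= => /= xi.
    by move: ix; rewrite -xi eqxx.
  by rewrite indicE mem_set ?mule1.
have iI i : m.-integrable setT (fun x => (\1_(lev i) x)%:E).
  apply/integrableP; split.
    exact/measurable_EFinP/measurable_indic.
  rewrite (eq_integral (fun x => (\1_(lev i) x)%:E)) => [|x _].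
    by rewrite integral_indic// setIT -ge0_fin_numE// mfin.
  by rewrite gee0_abs// lee_fin.
rewrite integral_sum//; last by move=> i; exact: integrableZl.
rewrite -sumEFin; apply: eq_bigr => i _.
by rewrite integralZl// integral_indic// setIT EFinM fineK// mfin.
Qed.

Lemma level_mass_sum (m : {measure set S -> \bar R}) : (m setT < +oo)%E ->
  \sum_i fine (m (lev i)) = fine (m setT).
Proof.
move=> moo; have := integral_levels (fun=> 1) moo.
rewrite integral_cst// mul1e => ->/=.
by under [RHS]eq_bigr do rewrite mul1r.
Qed.

Definition gibbs_prob (m h : I -> R) i :=
  m i * expR (h i) / \sum_j m j * expR (h j).

(** A Gibbs measure whose Hamiltonian is a function of the level is determined
    there by the masses of the levels under the reference measure. *)
Lemma gibbs_levels (mu : {measure set S -> \bar R}) (H : S -> R) (h : I -> R) :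
  (0 < mu setT < +oo)%E -> (forall x, H x = h (idx x)) ->
  exists2 G : probability S R, (G : set S -> \bar R) = gibbs mu H &
    forall i, fine (G (lev i)) = gibbs_prob (fun j => fine (mu (lev j))) h i.
Proof.
move=> /andP[mu0 muoo] Hh.
have -> : H = (fun x => h (idx x)) by exact/funext.
have mh := measurable_level_fun h.
pose g : {mfun S >-> R} := mfun_Sub (mem_set mh).
have ZE : (\int[mu]_x (expR (h (idx x)))%:E)%E =
    (\sum_i fine (mu (lev i)) * expR (h i))%:E.
  rewrite (integral_levels (fun i => expR (h i)) muoo).
  by congr (_%:E); apply: eq_bigr => i _; rewrite mulrC.
have [|G GE] := @gibbs_is_probability _ _ _ mu g.
  rewrite [exp_measure _ _ _]ZE ltry andbT lte_fin.
  apply: sum_exp_gt0 => [i|]; first exact: fine_ge0.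
  by rewrite level_mass_sum// fine_gt0// mu0.
exists G => // i; rewrite GE /gibbs /gibbs_prob /Rintegral ZE/=.
have -> : (\int[mu]_(x in lev i) (expR (h (idx x)))%:E =
    (expR (h i))%:E * mu (lev i))%E.
  rewrite -integral_cst//; apply: eq_integral => x.
  by rewrite inE => -> /=.
rewrite -(@fineK _ (mu (lev i)))//=; first by rewrite mulrC [in RHS](mulrC (fine _)).
rewrite ge0_fin_numE//; apply: le_lt_trans muoo.
by apply: le_measure => //; rewrite inE.
Qed.

End levels.

Lemma replica_expectation_levels d (S : measurableType d) (R : realType)
    (I : finType) (idx : S -> I) (midx : forall i, measurable (idx @^-1` [set i]))
    (G1 G2 : probability S R) (h : I -> I -> R) :
  replica_expectation G1 G2 (fun x => h (idx x.1) (idx x.2)) =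
  \sum_j \sum_k fine (G1 (idx @^-1` [set j])) * fine (G2 (idx @^-1` [set k]))
    * h j k.
Proof.
pose idx2 (x : S * S) := (idx x.1, idx x.2).
have lev2 i : idx2 @^-1` [set i] = (idx @^-1` [set i.1]) `*` (idx @^-1` [set i.2]).
  by case: i => i j; apply/seteqP; split => [[x y] /= [-> ->]//|[x y]] /= [<- <-].
have midx2 i : measurable (idx2 @^-1` [set i]).
  by rewrite lev2; exact: measurableX.
have mass : ((G1 \x G2) [set: S * S] < +oo)%E.
  by rewrite -setXTT product_measure1E//= !probability_setT mule1 ltry.
rewrite /replica_expectation.
rewrite (integral_levels midx2 (fun i => h i.1 i.2) mass)/= pair_bigA/=.
apply: eq_bigr => i _; rewrite lev2 product_measure1E// mulrC; congr (_ * _).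
by rewrite fineM// fin_num_measure.
Qed.

(** * The bound for one side *)

Lemma measurable_gibbs_prob d (T : measurableType d) (R : realType) (I : finType)
    (m h : I -> T -> R) i :
  (forall j x, 0 <= m j x) ->
  (forall j, measurable_fun setT (m j)) ->
  (forall j, measurable_fun setT (h j)) ->
  measurable_fun setT (fun x => gibbs_prob (m ^~ x) (h ^~ x) i).
Proof.
move=> m0 mm mh.
have -> : (fun x => gibbs_prob (m ^~ x) (h ^~ x) i) =
    (fun x => avg (fun j => m j x * expR (h j x)) (fun j => (j == i)%:R)).
  apply/funext => x; rewrite /gibbs_prob /avg; congr (_ / _).
  rewrite (bigD1 i)//= eqxx mulr1 big1 ?addr0// => j /negbTE ->.
  by rewrite mulr0.
apply: (@measurable_avg _ _ _ _ (fun j x => m j x * expR (h j x))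
  (fun j _ => (j == i)%:R)) => //.
- by move=> j x; rewrite mulr_ge0 ?expR_ge0.
- move=> j; apply: measurable_funM => //.
  exact: (measurableT_comp (@measurable_expR R)).
Qed.

Lemma gibbs_prob_ge0 (R : realType) (I : finType) (m h : I -> R) i :
  (forall j, 0 <= m j) -> 0 <= gibbs_prob m h i.
Proof.
move=> m0; rewrite divr_ge0 ?mulr_ge0 ?expR_ge0//.
by apply: sumr_ge0 => j _; rewrite mulr_ge0 ?expR_ge0.
Qed.

Lemma gibbs_prob_sum (R : realType) (I : finType) (m h : I -> R) :
  (forall j, 0 <= m j) -> 0 < \sum_j m j -> \sum_i gibbs_prob m h i = 1.
Proof. by move=> m0 M0; rewrite -mulr_suml divff// gt_eqF// sum_exp_gt0. Qed.

(** Both sides of the theorem are instances of this section, with the roles of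
    the two Gibbs measures exchanged: [shared], [own] and [other] give the
    places, in the family [X], of the variables common to both Hamiltonians, of
    those of the side whose conditional variance is bounded, and of those of
    the opposite side. *)
Section one_sided_bound.
Context d (T : measurableType d) (R : realType) (P : probability T R).
Local Notation int X := (P.-integrable setT (EFin \o X)).
Variables (E L I : finType) (X : L -> {mfun T >-> R}) (F : set (set T)).
Hypotheses (sF : sigma_algebra setT F) (mF : F `<=` measurable).
Hypotheses (Xind : mutually_independent P X)
           (FX : sigma_independent P F (sigma_family X)).
Hypotheses (iX2 : forall l, int (fun x => X l x ^+ 2))
  (EX : forall l, \int[P]_x X l x = 0)
  (EX2 : forall l, \int[P]_x (X l x ^+ 2) = 1).
Variables shared own other : E -> L.
Hypotheses (own_inj : injective own) (own_shared : forall e e', shared e' != own e)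
  (own_other : forall e e', other e' != own e).
Variables (a : E -> I -> R) (m n : I -> T -> R).
Hypothesis a1 : forall e j, `|a e j| <= 1.
Hypotheses (m0 : forall j x, 0 <= m j x) (M0 : forall x, 0 < \sum_j m j x)
           (n0 : forall j x, 0 <= n j x) (N0 : forall x, 0 < \sum_j n j x).
Hypotheses (Fm : forall j, @measurable_fun _ _ (g_sigma_algebraType F) _ setT (m j))
           (Fn : forall j, @measurable_fun _ _ (g_sigma_algebraType F) _ setT (n j)).
Variables (gamma gamma' t : R).
Hypotheses (gamma0 : 0 < gamma) (t1 : t < 1).

Definition energy (g : R) (v : E -> L) (j : I) (x : T) : R := g * \sum_e a e j *
  (Num.sqrt t * X (shared e) x + Num.sqrt (1 - t) * X (v e) x).

Let p j x := gibbs_prob (m ^~ x) (energy gamma own ^~ x) j.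
Let q k x := gibbs_prob (n ^~ x) (energy gamma' other ^~ x) k.
Let Q := mean_product a a.
Let c := gamma * Num.sqrt (1 - t).
Let G e := others_generator X F (own e).

Let c0 : 0 < c. Proof. by rewrite mulr_gt0// sqrtr_gt0 subr_gt0. Qed.

Let mG e : <<s G e >> `<=` measurable.
Proof. exact: others_generator_measurable. Qed.

Let YG e A B : measurable A -> <<s G e >> B ->
  P (X (own e) @^-1` A `&` B) = (P (X (own e) @^-1` A) * P B)%E.
Proof.
move=> mA GB; apply: (leave_one_out_indep sF mF Xind FX) GB.
by exists A => //; rewrite setTI.
Qed.

Let oF e (Z : T -> R) :
  @measurable_fun _ _ (g_sigma_algebraType F) _ setT Z -> observable (G e) Z.
Proof.
move=> mZ _ B mB; have := mZ measurableT B mB.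
by apply: sub_sigma_algebra2; left.
Qed.

Let oX e l : l != own e -> observable (G e) (X l).
Proof.
move=> le _ B mB; apply: sub_sigma_algebra; right; exists l => //.
by exists B.
Qed.

Let v j x := m j x *
  expR (gamma * \sum_e a e j * (Num.sqrt t * X (shared e) x)).

Let v0 j x : 0 <= v j x. Proof. by rewrite mulr_ge0 ?expR_ge0. Qed.

Let V0 x : 0 < \sum_j v j x.
Proof. exact: (sum_exp_gt0 _ (m0 ^~ x) (M0 x)). Qed.

Let ov e j : observable (G e) (v j).
Proof.
apply: measurable_funM; first exact: oF.
apply: (measurableT_comp (@measurable_expR R)); apply: measurable_funM => //.
apply: measurable_sum => e'; apply: measurable_funM => //.
by apply: measurable_funM => //; exact: oX.
Qed.

Let oq e k : observable (G e) (q k).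
Proof.
apply: measurable_gibbs_prob => // j; first exact: oF.
apply: measurable_funM => //; apply: measurable_sum => e'.
apply: measurable_funM => //.
by apply: measurable_funD; apply: measurable_funM => //; exact: oX.
Qed.

Let pE : p = exp_prob (fun e => X (own e)) a v c.
Proof.
have wE j x : m j x * expR (energy gamma own j x) =
    exp_weight (fun e => X (own e)) a v c j x.
  rewrite /exp_weight /v -mulrA -expRD /energy; congr (_ * expR _).
  rewrite !mulr_sumr -big_split/=; apply: eq_bigr => e _; rewrite /c; ring.
apply/funext => j; apply/funext => x; rewrite /p /gibbs_prob /exp_prob wE.
by congr (_ / _); apply: eq_bigr => i _; rewrite wE.
Qed.

Let oY e e' : e' != e -> observable (G e) (X (own e')).
Proof. by move=> e'e; apply: oX; rewrite (inj_eq own_inj). Qed.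

Let q0 k x : 0 <= q k x. Proof. exact: gibbs_prob_ge0. Qed.
Let q1 x : \sum_k q k x = 1. Proof. exact: gibbs_prob_sum. Qed.

Lemma gibbs_mean_cond_var_integrable :
  int (fun x => mean_cond_var (p ^~ x) (q ^~ x) Q).
Proof.
rewrite pE.
exact: (integrable_mean_cond_var P mG oY a1 a1 c0 v0 q0 q1 ov oq).
Qed.

Lemma gibbs_mean_cond_var_le :
  \int[P]_x mean_cond_var (p ^~ x) (q ^~ x) Q <= (c * Num.sqrt #|E|%:R)^-1 +
    #|E|%:R^-1 * \sum_e (\int[P]_x taylor_error c (X (own e) x) + 6 * c).
Proof.
rewrite pE.
exact: (mean_cond_var_le mG YG (fun e => iX2 (own e)) (fun e => EX (own e))
  (fun e => EX2 (own e)) oY a1 a1 c0 v0 V0 q0 q1 ov oq).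
Qed.

End one_sided_bound.

Section tail_bounds.
Context d (T : measurableType d) (R : realType) (P : probability T R).
Local Notation int X := (P.-integrable setT (EFin \o X)).
Variable Y : {mfun T >-> R}.
Hypotheses (iY2 : int (fun x => Y x ^+ 2)) (EY2 : \int[P]_x (Y x ^+ 2) = 1).
Variables (c : R) (c0 : 0 <= c).

Let tail (K : R) (x : T) : R := `|Y x| ^+ 2 * \1_[set w | K <= `|Y w|] x.

Lemma integrable_tail K : int (tail K).
Proof.
apply: (@le_integrable_real _ _ _ _ _ (fun x => Y x ^+ 2)) => //.
  apply: measurable_funM.
    by apply: measurable_funX; exact: measurableT_comp.
  apply: measurable_indic.
  rewrite -[X in measurable X]setTI.
  have mY : measurable_fun setT (fun x => `|Y x|) by exact: measurableT_comp.
  have := mY measurableT `[K, +oo[%classic (measurable_itv _).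
  by congr measurable; apply/seteqP; split => x /=; rewrite in_itv/= andbT.
move=> x; rewrite /tail real_normK ?num_real// normrM !ger0_norm ?sqr_ge0//.
by rewrite ler_piMr ?sqr_ge0// indic_le1.
Qed.

(** The two competing bounds in [taylor_error] are used on either side of the
    threshold [K]. *)
Lemma taylor_error_tail K : 1 <= K ->
  \int[P]_x taylor_error c (Y x) <= 4 * \int[P]_x tail K x + 6 * c * K.
Proof.
move=> K1; have K0 : 0 <= K by apply: le_trans K1.
have -> : 4 * \int[P]_x tail K x + 6 * c * K =
    \int[P]_x (4 * tail K x + 6 * c * K * Y x ^+ 2).
  rewrite RintegralD//; try by apply: integrable_realZ => //; exact: integrable_tail.
  by rewrite !RintegralZl ?EY2 ?mulr1//; exact: integrable_tail.
apply: le_Rintegral => //.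
- exact: integrable_taylor_error.
- by apply: integrable_realD; apply: integrable_realZ => //; exact: integrable_tail.
move=> x _; rewrite /taylor_error /tail -(real_normK (num_real (Y x))) indicE.
set s : R := `|Y x|; have s0 : 0 <= s by exact: normr_ge0.
have [Ks|sK] := leP K s.
  rewrite mem_set//= mulr1.
  apply: (@le_trans _ _ (s * (4 * s))).
    by rewrite ler_wpM2l// ge_min lexx.
  have := mulr_ge0 (mulr_ge0 c0 K0) (sqr_ge0 s); lra.
rewrite memNset/=; last by apply/negP; rewrite -ltNge.
rewrite mulr0 mulr0 add0r.
apply: (@le_trans _ _ (s * (6 * c * s ^+ 2))).
  by rewrite ler_wpM2l// ge_min lexx orbT.
have Ks0 : 0 <= K - s by rewrite subr_ge0 ltW.
have := mulr_ge0 (mulr_ge0 c0 (sqr_ge0 s)) Ks0; lra.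
Qed.

Hypothesis iY3 : int (fun x => `|Y x| ^+ 3).

(** From [3 * s ^+ 2 <= 2 * s ^+ 3 + 1] for [0 <= s]. *)
Lemma third_moment_ge1 : 1 <= \int[P]_x (`|Y x| ^+ 3).
Proof.
have : \int[P]_x (3 * Y x ^+ 2) <= \int[P]_x (2 * `|Y x| ^+ 3 + 1).
  apply: le_Rintegral => //; first exact: integrable_realZ.
    by apply: integrable_realD; [exact: integrable_realZ|exact: integrable_cst].
  move=> x _; rewrite -(real_normK (num_real (Y x))).
  set s : R := `|Y x|; have s0 : 0 <= s by exact: normr_ge0.
  have := mulr_ge0 (sqr_ge0 (s - 1)) (_ : 0 <= 2 * s + 1).
  by move=> /(_ ltac:(lra)); lra.
rewrite RintegralZl// EY2 RintegralD//; first last.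
- exact: integrable_cst.
- exact: integrable_realZ.
rewrite RintegralZl// Rintegral_cst// [X in fine X]probability_setT/=; lra.
Qed.

Lemma taylor_error_third_moment :
  \int[P]_x taylor_error c (Y x) <= 6 * c * \int[P]_x (`|Y x| ^+ 3).
Proof.
rewrite -RintegralZl//; apply: le_Rintegral => //.
- exact: integrable_taylor_error.
- exact: integrable_realZ.
move=> x _; rewrite /taylor_error.
have -> : 6 * c * `|Y x| ^+ 3 = `|Y x| * (6 * c * `|Y x| ^+ 2) by ring.
by rewrite ler_wpM2l// ge_min lexx orbT.
Qed.

End tail_bounds.

(** * The variance of the overlap *)

Lemma standardized_moments d (T : measurableType d) (R : realType)
    (P : probability T R) (X : {mfun T >-> R}) :
  ('E_P[X] = 0)%E -> ('V_P[X] = 1)%E ->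
  [/\ P.-integrable setT (EFin \o (fun x => X x ^+ 2)),
      \int[P]_x X x = 0 & \int[P]_x (X x ^+ 2) = 1].
Proof.
move=> EX VX.
have E2 : (\int[P]_x (X x ^+ 2)%:E = 1)%E.
  move: VX; rewrite /variance covariance.unlock EX/= expectation.unlock => <-.
  apply: eq_integral => x _.
  by rewrite -[RHS]/(((X x - 0) * (X x - 0))%:E) subr0 expr2.
split.
- apply/integrableP; split.
    by apply/measurable_EFinP; exact: measurable_funX.
  rewrite (eq_integral (fun x => (X x ^+ 2)%:E)) ?E2 ?ltry// => x _.
  by rewrite /= ger0_norm// sqr_ge0.
- by move: EX; rewrite expectation.unlock /Rintegral => ->.
- by rewrite /Rintegral E2.
Qed.

Section variance_bound.
Variables (R : realType) (dO : measure_display) (Omega : measurableType dO)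
  (P : probability Omega R) (dS : measure_display) (Sigma : measurableType dS).
Hypothesis hSigma : finite_set [set: Sigma].
Variables (E : finType) (f : E -> {mfun Sigma >-> R}).
Hypothesis hf : forall (e : E) (x : Sigma), `|f e x| <= 1.
Variables y y1 y2 : E -> {RV P >-> R}.
Hypotheses (hmean : forall i : (E + E + E)%type,
    ('E_P[disorder y y1 y2 i] = 0)%E)
  (hvar : forall i : (E + E + E)%type, ('V_P[disorder y y1 y2 i] = 1)%E)
  (hindep : mutually_independent P (disorder y y1 y2)).
Variables mu1 mu2 : R.-ftker Omega ~> Sigma.
Hypotheses (hmu1 : forall w : Omega, (0 < mu1 w [set: Sigma])%E)
  (hmu2 : forall w : Omega, (0 < mu2 w [set: Sigma])%E)
  (hmu : sigma_independent P (sigma_random_measures mu1 mu2)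
           (sigma_family (disorder y y1 y2))).
Variables (gamma1 gamma2 t : R).
Hypotheses (hgamma1 : 0 < gamma1) (hgamma2 : 0 < gamma2) (ht1 : t < 1).

Let G1 w := gibbs (mu1 w)
  (hamiltonian f gamma1 t (fun e => y e w) (fun e => y1 e w)).
Let G2 w := gibbs (mu2 w)
  (hamiltonian f gamma2 t (fun e => y e w) (fun e => y2 e w)).

(** What [gibbs_mean_cond_var_le] gives for the side with inverse temperature
    [gamma] and own variables [Y]. *)
Definition one_side_bound (gamma : R) (Y : E -> Omega -> R) : R :=
  let c := gamma * Num.sqrt (1 - t) in
  (c * Num.sqrt #|E|%:R)^-1 +
  #|E|%:R^-1 * \sum_e (\int[P]_x taylor_error c (Y e x) + 6 * c).

Let X (i : (E + E + E)%type) : {mfun Omega >-> R} :=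
  match i with inl (inl e) => y e | inl (inr e) => y1 e | inr e => y2 e end.

Let XE : (fun i => X i : Omega -> R) = disorder y y1 y2.
Proof. by apply/funext => -[[e|e]|e]. Qed.

Let F := sigma_random_measures mu1 mu2.

Let mF : F `<=` measurable.
Proof.
apply: smallest_sub; first exact: sigma_algebra_measurable.
move=> _ [A mA] [[B mB <-]|[B mB <-]].
  exact: (@measurable_kernel _ _ _ _ _ mu1 A mA measurableT).
exact: (@measurable_kernel _ _ _ _ _ mu2 A mA measurableT).
Qed.

(** On the levels of the family [f] both Gibbs measures are finite laws, to which
    [efron_stein] applies for each value of the disorder; the expectations of
    its two terms are instances of [gibbs_mean_cond_var_le]. *)
Lemma overlap_variance_expectation_le :
  ('E_P[fun w => overlap_variance f (G1 w) (G2 w)] <=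
    (one_side_bound gamma1 y1 + one_side_bound gamma2 y2)%:E)%E.
Proof.
have [I [idx [a [midx fE idx_surj]]]] := finite_levels f hSigma.
have a1 e i : `|a e i| <= 1.
  by have [x <-] := idx_surj i; rewrite -fE.
pose m1 (j : I) w : R := fine (mu1 w (idx @^-1` [set j])).
pose m2 (j : I) w : R := fine (mu2 w (idx @^-1` [set j])).
have mass (k : R.-ftker Omega ~> Sigma) w : (k w setT < +oo)%E.
  rewrite -ge0_fin_numE//; exact: kernel_finite_transition.
have m10 j w : 0 <= m1 j w by exact: fine_ge0.
have m20 j w : 0 <= m2 j w by exact: fine_ge0.
have M10 w : 0 < \sum_j m1 j w.
  by rewrite (level_mass_sum midx (mass mu1 w)) fine_gt0// hmu1 mass.
have M20 w : 0 < \sum_j m2 j w.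
  by rewrite (level_mass_sum midx (mass mu2 w)) fine_gt0// hmu2 mass.
have Fm1 j : @measurable_fun _ _ (g_sigma_algebraType F) _ setT (m1 j).
  apply: (measurableT_comp (f := @fine R)) => // _ B mB.
  apply: sub_sigma_algebra; apply: sub_sigma_algebra.
  by exists (idx @^-1` [set j]) => //; left; exists B.
have Fm2 j : @measurable_fun _ _ (g_sigma_algebraType F) _ setT (m2 j).
  apply: (measurableT_comp (f := @fine R)) => // _ B mB.
  apply: sub_sigma_algebra; apply: sub_sigma_algebra.
  by exists (idx @^-1` [set j]) => //; right; exists B.
have sF : sigma_algebra setT F by exact: smallest_sigma_algebra.
have Fmeas (Z : Omega -> R) :
    @measurable_fun _ _ (g_sigma_algebraType F) _ setT Z -> measurable_fun setT Z.
  move=> mZ _ B mB; apply: mF; have := mZ measurableT B mB.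
  by rewrite measurable_g_measurableTypeE.
pose sh (e : E) : (E + E + E)%type := inl (inl e).
pose s1 (e : E) : (E + E + E)%type := inl (inr e).
pose s2 (e : E) : (E + E + E)%type := inr e.
have Xind : mutually_independent P (fun i => X i : Omega -> R) by rewrite XE.
have FX : sigma_independent P F (sigma_family (fun i => X i : Omega -> R)).
  by rewrite XE.
have mom i : [/\ P.-integrable setT (EFin \o (fun x => X i x ^+ 2)),
    \int[P]_x X i x = 0 & \int[P]_x (X i x ^+ 2) = 1].
  apply: standardized_moments; first by rewrite -(hmean i) -XE.
  by rewrite -(hvar i) -XE.
have iX2 i := let: And3 h _ _ := mom i in h.
have EX i := let: And3 _ h _ := mom i in h.
have EX2 i := let: And3 _ _ h := mom i in h.
pose h1 := energy X sh a t gamma1 s1; pose h2 := energy X sh a t gamma2 s2.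
pose p1 j w := gibbs_prob (m1 ^~ w) (h1 ^~ w) j.
pose p2 j w := gibbs_prob (m2 ^~ w) (h2 ^~ w) j.
pose Q := mean_product a a.
have s1_inj : injective s1 by move=> e e' [].
have s2_inj : injective s2 by move=> e e' [].
have half1 := gibbs_mean_cond_var_le sF mF Xind FX iX2 EX EX2 s1_inj
  (fun e e' => isT : sh e' != s1 e) (fun e e' => isT : s2 e' != s1 e) a1
  m10 M10 m20 M20 Fm1 Fm2 gamma2 hgamma1 ht1.
have half2 := gibbs_mean_cond_var_le sF mF Xind FX iX2 EX EX2 s2_inj
  (fun e e' => isT : sh e' != s2 e) (fun e e' => isT : s1 e' != s2 e) a1
  m20 M20 m10 M10 Fm2 Fm1 gamma1 hgamma2 ht1.
have int1 := gibbs_mean_cond_var_integrable P X sF mF s1_inj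
  (fun e e' => isT : sh e' != s1 e) (fun e e' => isT : s2 e' != s1 e) a1
  m10 m20 M20 Fm1 Fm2 gamma2 hgamma1 ht1.
have int2 := gibbs_mean_cond_var_integrable P X sF mF s2_inj
  (fun e e' => isT : sh e' != s2 e) (fun e e' => isT : s1 e' != s2 e) a1
  m20 m10 M10 Fm2 Fm1 gamma1 hgamma2 ht1.
have mp1 j : measurable_fun setT (p1 j).
  apply: measurable_gibbs_prob => // i; first exact: Fmeas.
  apply: measurable_funM => //; apply: measurable_sum => e.
  apply: measurable_funM => //.
  by apply: measurable_funD; apply: measurable_funM => //; exact: measurable_funPT.
have mp2 j : measurable_fun setT (p2 j).
  apply: measurable_gibbs_prob => // i; first exact: Fmeas.
  apply: measurable_funM => //; apply: measurable_sum => e.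
  apply: measurable_funM => //.
  by apply: measurable_funD; apply: measurable_funM => //; exact: measurable_funPT.
pose V w := \sum_j \sum_k p1 j w * p2 k w *
  (Q j k - \sum_j' \sum_k' p1 j' w * p2 k' w * Q j' k') ^+ 2.
have p10 j w : 0 <= p1 j w by exact: gibbs_prob_ge0.
have p20 j w : 0 <= p2 j w by exact: gibbs_prob_ge0.
have V0 w : 0 <= V w.
  apply: sumr_ge0 => j _; apply: sumr_ge0 => k _.
  by rewrite mulr_ge0 ?sqr_ge0// mulr_ge0.
have mV : measurable_fun setT V.
  apply: measurable_sum => j; apply: measurable_sum => k.
  apply: measurable_funM; first exact: measurable_funM.
  apply: measurable_funX; apply: measurable_funB => //.
  apply: measurable_sum => j'; apply: measurable_sum => k'.
  by apply: measurable_funM => //; exact: measurable_funM.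
have QE x : cross_overlap f x = Q (idx x.1) (idx x.2).
  rewrite /cross_overlap /Q /mean_product; congr (_ * _).
  by apply: eq_bigr => e _; rewrite !fE.
have VE w : overlap_variance f (G1 w) (G2 w) = V w.
  have [||g1 g1E g1p] := @gibbs_levels _ Sigma R I idx midx (mu1 w)
    (hamiltonian f gamma1 t (fun e => y e w) (fun e => y1 e w)) (h1 ^~ w).
  - by rewrite hmu1 mass.
  - move=> x; rewrite /hamiltonian /h1 /energy; congr (_ * _).
    by apply: eq_bigr => e _; rewrite fE.
  have [||g2 g2E g2p] := @gibbs_levels _ Sigma R I idx midx (mu2 w)
    (hamiltonian f gamma2 t (fun e => y e w) (fun e => y2 e w)) (h2 ^~ w).
  - by rewrite hmu2 mass.
  - move=> x; rewrite /hamiltonian /h2 /energy; congr (_ * _).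
    by apply: eq_bigr => e _; rewrite fE.
  rewrite /overlap_variance /G1 /G2 -g1E -g2E.
  have -> : cross_overlap f = (fun x => Q (idx x.1) (idx x.2)).
    exact/funext.
  rewrite (replica_expectation_levels midx g1 g2 Q).
  rewrite (replica_expectation_levels midx g1 g2 (fun j k => (Q j k - _) ^+ 2)).
  apply: eq_bigr => j _; apply: eq_bigr => k _; rewrite g1p g2p.
  congr (_ * (_ - _) ^+ 2); apply: eq_bigr => j' _; apply: eq_bigr => k' _.
  by rewrite g1p g2p.
have Qsym : (fun k j => Q j k) = Q.
  apply/funext => k; apply/funext => j; rewrite /Q /mean_product; congr (_ * _).
  by apply: eq_bigr => e _; rewrite mulrC.
have VM w : V w <= mean_cond_var (p1 ^~ w) (p2 ^~ w) Q +
                   mean_cond_var (p2 ^~ w) (p1 ^~ w) Q.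
  have S1 : \sum_j p1 j w = 1 by exact: gibbs_prob_sum.
  have S2 : \sum_j p2 j w = 1 by exact: gibbs_prob_sum.
  by have := efron_stein Q (p10 ^~ w) (p20 ^~ w) S1 S2; rewrite Qsym.
have iV : P.-integrable setT (EFin \o V).
  apply: le_integrable_real (integrable_realD int1 int2) => // w.
  by rewrite ger0_norm//; exact: VM.
rewrite (funext VE) expectation.unlock.
have -> : (\int[P]_w (V w)%:E = (\int[P]_w V w)%:E)%E.
  by rewrite /Rintegral fineK//; exact: integrable_fin_num.
rewrite lee_fin; apply: (@le_trans _ _ (\int[P]_w
    (mean_cond_var (p1 ^~ w) (p2 ^~ w) Q + mean_cond_var (p2 ^~ w) (p1 ^~ w) Q))).
  by apply: le_Rintegral => //; exact: integrable_realD.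
rewrite RintegralD//; exact: lerD.
Qed.

End variance_bound.

Lemma remainder_bound (R : realType) (g1 g2 s n : R) : 0 < g1 -> 0 < g2 ->
  0 <= s -> 0 <= n ->
  (g1 * s * n)^-1 + (g2 * s * n)^-1 <= 4 * (g1 + g2) / (g1 * g2 * (n * s)).
Proof.
move=> g10 g20 s0 n0.
have -> : 4 * (g1 + g2) / (g1 * g2 * (n * s)) =
    4 * ((g1 * s * n)^-1 + (g2 * s * n)^-1).
  rewrite !invfM; set s' := s^-1; set n' := n^-1.
  by field; rewrite !gt_eqF.
have : 0 <= (g1 * s * n)^-1 + (g2 * s * n)^-1.
  by rewrite addr_ge0// invr_ge0 !mulr_ge0// ltW.
lra.
Qed.

Section one_side_bounds.
Context (R : realType) d (T : measurableType d) (P : probability T R).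
Variables (E : finType) (Y : E -> {RV P >-> R}) (gamma t : R).
Hypotheses (hmean : forall e, ('E_P[Y e] = 0)%E)
           (hvar : forall e, ('V_P[Y e] = 1)%E).
Hypotheses (gamma0 : 0 < gamma).

Let c := gamma * Num.sqrt (1 - t).
Let c0 : 0 <= c. Proof. by rewrite mulr_ge0// ltW. Qed.

Let tail (K : R) (e : E) : \bar R :=
  expectation_on P (fun w => `|Y e w| ^+ 2) [set w | K <= `|Y e w|].

Let mean_le (u : E -> R) (C : R) : 0 <= C -> (forall e, u e <= C) ->
  #|E|%:R^-1 * \sum_e u e <= C.
Proof.
(* For empty [E] the mean is 0. *)
move=> C0 uC; have [N0|N0] := eqVneq (#|E|%:R : R) 0.
  by rewrite N0 invr0 mul0r.
rewrite mulrC ler_pdivrMr ?lt_def ?N0 ?ler0n//.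
rewrite mulrC mulr_natl -sumr_const; exact: ler_sum.
Qed.

Lemma tail_fin_num K e : tail K e \is a fin_num.
Proof.
have [iY2 _ _] := standardized_moments (hmean e) (hvar e).
rewrite /tail /expectation_on expectation.unlock.
exact: integrable_fin_num (integrable_tail iY2 K).
Qed.

Lemma one_side_bound_tail K : 1 <= K ->
  one_side_bound P t gamma Y <= (c * Num.sqrt #|E|%:R)^-1 +
    (16 / #|E|%:R * \sum_e fine (tail K e) + 36 * K * c).
Proof.
move=> K1; rewrite /one_side_bound -/c lerD2l.
apply: (@le_trans _ _ (#|E|%:R^-1 * \sum_e (4 * fine (tail K e) + 12 * c * K))).
  rewrite ler_wpM2l ?invr_ge0//; apply: ler_sum => e _.
  have [iY2 _ EY2] := standardized_moments (hmean e) (hvar e).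
  have := taylor_error_tail iY2 EY2 c0 K1.
  rewrite /tail /expectation_on expectation.unlock.
  have := ler_wpM2l c0 K1; rewrite mulr1 => cK.
  rewrite -[fine _]/(\int[P]_x _); lra.
rewrite big_split/= mulrDr; apply: lerD.
  rewrite -mulr_sumr mulrA mulrC (mulrC (16 / _)); apply: ler_wpM2l.
    apply: sumr_ge0 => e _; apply: fine_ge0.
    rewrite /tail /expectation_on; apply: expectation_ge0 => x.
    by rewrite mulr_ge0// exprn_ge0.
  by rewrite mulrC ler_wpM2r ?invr_ge0//; lra.
have cK := mulr_ge0 c0 (le_trans ler01 K1).
by apply: mean_le => [|e]; lra.
Qed.

(** As the third moment is at least 1, the error [6 * c] that carries no moment
    is absorbed by it. *)
Lemma one_side_bound_third_moment : (max_third_moment P Y < +oo)%E ->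
  one_side_bound P t gamma Y <= (c * Num.sqrt #|E|%:R)^-1 +
    36 * fine (max_third_moment P Y) * c.
Proof.
move=> Boo; rewrite /one_side_bound -/c lerD2l.
have B0 : (0 <= max_third_moment P Y)%E by exact: bigmax_ge_id.
have Bf : max_third_moment P Y \is a fin_num by rewrite ge0_fin_numE.
have b0 : 0 <= fine (max_third_moment P Y) by exact: fine_ge0.
have cb := mulr_ge0 c0 b0.
apply: mean_le => [|e]; first lra.
have [iY2 _ EY2] := standardized_moments (hmean e) (hvar e).
have Ele : ('E_P[(fun w => `|Y e w| ^+ 3)%R] <= max_third_moment P Y)%E.
  exact: le_bigmax.
have mY3 : measurable_fun setT (fun w => `|Y e w| ^+ 3).
  by apply: measurable_funX; exact: measurableT_comp.
have iY3 : P.-integrable setT (EFin \o (fun w => `|Y e w| ^+ 3)).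
  apply/integrableP; split; first exact/measurable_EFinP.
  apply: le_lt_trans Boo; apply: le_trans Ele; rewrite expectation.unlock.
  rewrite le_eqVlt; apply/orP; left; apply/eqP; apply: eq_integral => w _.
  by rewrite /= ger0_norm// exprn_ge0.
have le_b : \int[P]_w (`|Y e w| ^+ 3) <= fine (max_third_moment P Y).
  rewrite -lee_fin (fineK Bf); apply: le_trans Ele.
  by rewrite expectation.unlock /Rintegral fineK//; exact: integrable_fin_num.
have te := taylor_error_third_moment iY2 c0 iY3.
have ge1 := third_moment_ge1 iY2 EY2 iY3.
have := ler_wpM2l c0 le_b; have := ler_wpM2l c0 ge1; rewrite mulr1; lra.
Qed.

End one_side_bounds.

Unset Implicit Arguments.

Theorem theorem2 (R : realType)
  (dO : measure_display) (Omega : measurableType dO) (P : probability Omega R)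
  (dS : measure_display) (Sigma : measurableType dS)
  (hSigma : finite_set [set: Sigma])
  (E : finType) (f : E -> {mfun Sigma >-> R})
  (hf : forall (e : E) (x : Sigma), `|f e x| <= 1)
  (y y1 y2 : E -> {RV P >-> R})
  (hmean : forall i : (E + E + E)%type,
     ('E_P[disorder y y1 y2 i] = 0)%E)
  (hvar : forall i : (E + E + E)%type,
     ('V_P[disorder y y1 y2 i] = 1)%E)
  (hindep : mutually_independent P (disorder y y1 y2))
  (mu1 mu2 : R.-ftker Omega ~> Sigma)
  (hmu1 : forall w : Omega, (0 < mu1 w [set: Sigma])%E)
  (hmu2 : forall w : Omega, (0 < mu2 w [set: Sigma])%E)
  (hmu : sigma_independent P (sigma_random_measures mu1 mu2)
           (sigma_family (disorder y y1 y2)))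
  (gamma1 gamma2 : R) (hgamma1 : 0 < gamma1) (hgamma2 : 0 < gamma2)
  (t : R) (ht0 : 0 <= t) (ht1 : t < 1) :
  let G1 w := gibbs (mu1 w)
    (hamiltonian f gamma1 t (fun e => y e w) (fun e => y1 e w)) in
  let G2 w := gibbs (mu2 w)
    (hamiltonian f gamma2 t (fun e => y e w) (fun e => y2 e w)) in
  let variance_Q := ('E_P[fun w => overlap_variance f (G1 w) (G2 w)])%E in
  let rem : R := 4 * (gamma1 + gamma2)
    / (gamma1 * gamma2 * Num.sqrt (#|E|%:R * (1 - t))) in
  let B1 := max_third_moment P y1 in
  let B2 := max_third_moment P y2 in
  (forall K : R, 1 <= K ->
     (variance_Q <= truncation_bound P y1 y2 gamma1 gamma2 t K + rem%:E)%E)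
  /\
  ((B1 < +oo)%E -> (B2 < +oo)%E ->
     (variance_Q <= 36%:E * (B1 * gamma1%:E + B2 * gamma2%:E)
                      * (Num.sqrt (1 - t))%:E + rem%:E)%E).
Proof.
move=> G1 G2 variance_Q rem B1 B2.
have V : (variance_Q <=
    (one_side_bound P t gamma1 y1 + one_side_bound P t gamma2 y2)%:E)%E.
  exact: (overlap_variance_expectation_le hSigma hf hmean hvar hindep hmu1 hmu2
    hmu hgamma1 hgamma2 ht1).
set s := Num.sqrt (1 - t); set n := Num.sqrt (#|E|%:R : R).
have s0 : 0 <= s by exact: sqrtr_ge0.
have remE : (gamma1 * s * n)^-1 + (gamma2 * s * n)^-1 <= rem.
  by rewrite /rem sqrtrM ?ler0n//; apply: remainder_bound => //; exact: sqrtr_ge0.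
have m1 e : ('E_P[y1 e] = 0)%E := hmean (inl (inr e)).
have m2 e : ('E_P[y2 e] = 0)%E := hmean (inr e).
have v1 e : ('V_P[y1 e] = 1)%E := hvar (inl (inr e)).
have v2 e : ('V_P[y2 e] = 1)%E := hvar (inr e).
split=> [K K1|B1oo B2oo].
- apply: le_trans V _.
  have b1 := one_side_bound_tail t m1 v1 hgamma1 K1.
  have b2 := one_side_bound_tail t m2 v2 hgamma2 K1.
  rewrite /truncation_bound.
  under eq_bigr => e _.
    rewrite -(fineK (tail_fin_num m1 v1 K e)) -(fineK (tail_fin_num m2 v2 K e)).
    rewrite -EFinD.
    over.
  rewrite sumEFin -EFinM -!EFinD lee_fin big_split/=.
  move: b1 b2 remE; rewrite -/s -/n; lra.
- apply: le_trans V _.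
  have b1 := one_side_bound_third_moment t m1 v1 hgamma1 B1oo.
  have b2 := one_side_bound_third_moment t m2 v2 hgamma2 B2oo.
  have fB (Y : E -> {RV P >-> R}) : (max_third_moment P Y < +oo)%E ->
      max_third_moment P Y \is a fin_num.
    by move=> Yoo; rewrite ge0_fin_numE//; exact: bigmax_ge_id.
  rewrite /B1 /B2 -(fineK (fB y1 B1oo)) -(fineK (fB y2 B2oo)).
  rewrite -!EFinM -EFinD lee_fin.
  move: b1 b2 remE; rewrite -/s -/n; lra.
Qed.
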